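(* There is an uncountable family $\mathcal{M}$ of pairwise non-isomorphic maximal subgroups of Thompson's group $V$. Moreover, every $G$ in $\mathcal{M}$ arises as the stabilizer $\operatorname{Stab}_V(\mathcal{P})$ of a simple nuclear type system $\mathcal{P}$ on $\Omega$, does not preserve any circular order on any dense set of points in $\mathfrak{C}$, and does not stabilize (setwise) any non-empty finite set of points in $\mathfrak{C}$.
   Context: $\mathfrak{C}$ is the Cantor space of infinite words over $\{0,1\}$ (product topology) and $\Omega$ is the set of all finite words over $\{0,1\}$ (including the empty word), called addresses; $|\alpha|$ is the length of $\alpha$. For $\alpha\in\Omega$ the cone is $\alpha\mathfrak{C}=\{\alpha w\mid w\in\mathfrak{C}\}$. Thompson's group $V$ is the group (under composition) of all maps $\mathfrak{C}\to\mathfrak{C}$ for which there are two partitions $\alpha_1\mathfrak{C},\dots,\alpha_n\mathfrak{C}$ and $\beta_1\mathfrak{C},\dots,\beta_n\mathfrak{C}$ of $\mathfrak{C}$ into disjoint cones such that $\alpha_iw\mapsto\beta_iw$ for all $i$ and all $w\in\mathfrak{C}$. $V$ acts partially on $\Omega$ on the right: $\alpha^g=\beta$ if $g$ maps $\alpha w\mapsto\beta w$ for all $w\in\mathfrak{C}$; if there is no such $\beta$, then $\alpha^g$ is undefined. A subgroup $G\le V$ preserves a circular order on a dense set of points if there are a dense $G$-invariant subset $D\subseteq\mathfrak{C}$ and a (strict, total) circular order on $D$ that is invariant under the action of $G$ on $D$. A type system on $\Omega$ is the partition $\mathcal{P}$ of $\Omega$ into the classes (called types) of an equivalence relation $\sim$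 such that for all $\alpha,\beta\in\Omega$: $\alpha\sim\beta$ if and only if both $\alpha0\sim\beta0$ and $\alpha1\sim\beta1$. A type system $\mathcal{Q}$ (relation $\approx$) is a quotient of $\mathcal{P}$ if $\alpha\sim\beta$ implies $\alpha\approx\beta$; it is proper if $\mathcal{Q}\ne\mathcal{P}$. The universal relation is the one in which all addresses are related. $\mathcal{P}$ is simple if its only proper quotient is the type system of the universal relation (in particular the universal type system itself is not simple). $\operatorname{Stab}_V(\mathcal{P})$ is the subgroup of all $g\in V$ for which there is a cofinite $\Omega_0\subseteq\Omega$ such that $\alpha^g$ is defined for all $\alpha\in\Omega_0$ and, for all $\alpha,\beta\in\Omega_0$, $\alpha\sim\beta$ if and only if $\alpha^g\sim\beta^g$. For $P\in\mathcal{P}$ and $\gamma\in\Omega$, $P_\gamma$ denotes the type of $\alpha\gamma$ for any $\alpha\in P$. A type system $\mathcal{P}$ is nuclear if there are a positive integer $t$ and a non-empty subset $\mathcal{Q}\subseteq\mathcal{P}$ such that every address $\alpha$ with $|\alpha|\ge t$ has type in $\mathcal{Q}$; $\mathcal{Q}$ is child-closed ($P\in\mathcal{Q}$ implies $P_0,P_1\in\mathcal{Q}$); and $\mathcal{Q}$ is strongly connected (for all $P,Q\in\mathcal{Q}$ there is a non-empty word $\gamma$ with $P_\gamma=Q$ and $P_\zeta\in\mathcal{Q}$ for every prefix $\zeta$ of $\gamma$). *)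

(* Defs.v *)
From HB Require Import structures.
From mathcomp Require Import all_boot all_order all_algebra.
From mathcomp Require Import all_classical all_reals all_analysis.

Set Implicit Arguments.
Unset Strict Implicit.
Unset Printing Implicit Defensive.

Local Open Scope classical_set_scope.

Definition address := seq bool.

Definition prepend (a : address) (w : cantor_space) : cantor_space :=
  fun i => nth (w (i - size a)%N) a i.

Definition cone (a : address) : set cantor_space := range (prepend a).

Definition thompsonV : set (cantor_space -> cantor_space) :=
  [set g | exists (n : nat) (a b : 'I_n -> address),
    [/\ partition [set: 'I_n] (fun i => cone (a i)) [set: cantor_space],
        partition [set: 'I_n] (fun i => cone (b i)) [set: cantor_space] &
        forall i w, g (prepend (a i) w) = prepend (b i) w]].

(* The graph of the partial action: b is the address written a^g.  Such a b,
   if it exists, is unique. *)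
Definition address_act (g : cantor_space -> cantor_space) (a b : address) : Prop :=
  forall w, g (prepend a w) = prepend b w.

Definition group_of_maps (T : Type) (G : set (T -> T)) : Prop :=
  [/\ G id,
      forall g h, G g -> G h -> G (g \o h) &
      forall g, G g -> exists2 h, G h & cancel g h /\ cancel h g].

Definition subgroup (T : Type) (V G : set (T -> T)) : Prop :=
  group_of_maps G /\ G `<=` V.

Definition maximal_subgroup (T : Type) (V G : set (T -> T)) : Prop :=
  [/\ subgroup V G, G <> V &
      forall H, subgroup V H -> G `<=` H -> H = G \/ H = V].

Definition isomorphic (T : Type) (G H : set (T -> T)) : Prop :=
  exists phi : (T -> T) -> (T -> T),
    set_bij G H phi /\
    forall g h, G g -> G h -> phi (g \o h) = phi g \o phi h.

Definition circular_order_on (T : Type) (D : set T) (c : T -> T -> T -> Prop) : Prop :=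
  [/\ forall x y z, D x -> D y -> D z -> c x y z -> c y z x,
      (* This forces x, y, z to be pairwise distinct whenever c x y z, given
         cyclicity: the order is strict. *)
      forall x y z, D x -> D y -> D z -> c x y z -> ~ c x z y,
      forall x y z t, D x -> D y -> D z -> D t -> c x y z -> c x z t -> c x y t &
      forall x y z, D x -> D y -> D z -> x <> y -> y <> z -> x <> z ->
        c x y z \/ c x z y].

Definition preserves_circular_order_on_dense_set
    (T : topologicalType) (G : set (T -> T)) : Prop :=
  exists (D : set T) (c : T -> T -> T -> Prop),
    [/\ dense D,
        forall g x, G g -> D x -> D (g x),
        circular_order_on D c &
        forall g x y z, G g -> D x -> D y -> D z ->
          (c x y z <-> c (g x) (g y) (g z))].

Definition stabilizes_setwise (T : Type) (G : set (T -> T)) (F : set T) : Prop :=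
  forall g, G g -> g @` F = F.

(* A type system is given by its equivalence relation; its types are the
   classes, see [types] below. *)
Definition type_system (R : address -> address -> Prop) : Prop :=
  RelationClasses.Equivalence R /\
  forall a b, R a b <->
    R (rcons a false) (rcons b false) /\ R (rcons a true) (rcons b true).

Definition universal_relation (R : address -> address -> Prop) : Prop :=
  forall a b, R a b.

Definition proper_quotient (R Q : address -> address -> Prop) : Prop :=
  (forall a b, R a b -> Q a b) /\ ~ (forall a b, Q a b <-> R a b).

(* The proper quotients of R are exactly the universal type system; in
   particular R itself is not universal. *)
Definition simple_type_system (R : address -> address -> Prop) : Prop :=
  type_system R /\
  forall Q, type_system Q -> (proper_quotient R Q <-> universal_relation Q).

Definition type_of (R : address -> address -> Prop) (a : address) : set address :=
  [set b | R a b].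

Definition types (R : address -> address -> Prop) : set (set address) :=
  range (type_of R).

(* P_gamma.  For a type P of a type system R, the union ranges over copies of
   one and the same type. *)
Definition type_descendant (R : address -> address -> Prop)
    (P : set address) (gamma : address) : set address :=
  \bigcup_(a in P) type_of R (a ++ gamma).

Definition nuclear_type_system (R : address -> address -> Prop) : Prop :=
  type_system R /\
  exists (t : nat) (Q : set (set address)),
    [/\ (0 < t)%N, Q `<=` types R & Q !=set0] /\
    [/\ forall a : address, (t <= size a)%N -> Q (type_of R a),
        forall P, Q P -> Q (type_descendant R P [:: false]) /\
                         Q (type_descendant R P [:: true]) &
        forall P P', Q P -> Q P' ->
          exists gamma : address,
            [/\ gamma <> [::],
                type_descendant R P gamma = P' &
                forall zeta, prefix zeta gamma -> Q (type_descendant R P zeta)]].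

Definition stabilizerV (R : address -> address -> Prop) :
    set (cantor_space -> cantor_space) :=
  [set g | thompsonV g /\
    exists Omega0 : set address,
      [/\ cofinite_set Omega0,
          forall a, Omega0 a -> exists a', address_act g a a' &
          forall a b a' b', Omega0 a -> Omega0 b ->
            address_act g a a' -> address_act g b b' -> (R a b <-> R a' b')]].

(* Main.v *)
From HB Require Import structures.
Require Import Defs.
From mathcomp Require Import all_boot all_order all_algebra.
From mathcomp Require Import all_classical all_reals all_analysis.
From mathcomp Require Import zify.

(* The types are the states of an automaton whose states carry weights, the weight of a
   state being the sum of the weights of its two children.  For an injective sequence of
   primes m, the state [unit_state k] of weight 1 / (m 0 * ... * m (k - 1)) breaks up into m k
   copies of [unit_state (k + 1)] and one state of weight 0, from which the root [unit_state 0] is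
   reached again.  Identifying any two states forces all of them to be identified.

   A subgroup H of V containing the stabilizer of a simple type system defines a type
   system: a and b are related if H contains the transpositions of disjoint cones of the
   types of a and b.  If it is the original one, then H is the stabilizer; if it is
   universal, then H contains all transpositions of cones and these generate V.

   If p >= 5 is one of the primes m k, then the root divides into cones that can be permuted
   freely by an element of order p preserving types; otherwise the weight mod p of the root
   would be both 1 and a multiple of p.  The existence of an element of order p without fixed
   points is an isomorphism invariant because disjointness of supports is expressible in the
   language of groups, as in the proofs of Rubin's theorem. *)

Set Implicit Arguments.
Unset Strict Implicit.
Unset Printing Implicit Defensive.

Local Open Scope classical_set_scope.

(** * Prefixes and the partial action of Thompson's group on addresses *)

Notation cantor := cantor_space.

Definition xtake (n : nat) (x : cantor) : address := mkseq x n.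
Definition xdrop (n : nat) (x : cantor) : cantor := fun i => x (n + i)%N.
Definition in_cone (a : address) (x : cantor) : bool := xtake (size a) x == a.
Definition incomp (a b : address) : bool := ~~ prefix a b && ~~ prefix b a.

Lemma size_xtake n x : size (xtake n x) = n.
Proof. exact: size_mkseq. Qed.

Lemma take_xtake m n x : (m <= n)%N -> take m (xtake n x) = xtake m x.
Proof. by move=> mn; rewrite /xtake /mkseq -map_take take_iota (minn_idPl mn). Qed.

Lemma xtake_eqP n (x y : cantor) :
  xtake n x = xtake n y <-> forall i, (i < n)%N -> x i = y i.
Proof.
split=> [E i iln|E]; last first.
  by apply/eq_in_map => i; rewrite mem_iota add0n => /andP[_ /E].
by rewrite -(nth_mkseq (x 0%N) x iln) -(nth_mkseq (x 0%N) y iln) -/(xtake n x) E.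
Qed.

Lemma xtake_le m n (x y : cantor) :
  (m <= n)%N -> xtake n x = xtake n y -> xtake m x = xtake m y.
Proof. by move=> mn /xtake_eqP E; apply/xtake_eqP => i im; apply: E; lia. Qed.

Lemma xtake_prepend a w : xtake (size a) (prepend a w) = a.
Proof.
apply: (@eq_from_nth _ false) => [|i]; rewrite size_xtake // => ia.
by rewrite nth_mkseq // /prepend (set_nth_default false).
Qed.

Lemma xdrop_prepend a w : xdrop (size a) (prepend a w) = w.
Proof.
apply/funext => i; rewrite /xdrop /prepend nth_default ?leq_addr //.
by rewrite addKn.
Qed.

Lemma prepend_xtake n x : prepend (xtake n x) (xdrop n x) = x.
Proof.
apply/funext => i; rewrite /prepend size_xtake /xdrop.
case: (ltnP i n) => [iln|nli]; first by rewrite nth_mkseq.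
by rewrite nth_default ?size_xtake // subnKC.
Qed.

Lemma prepend_nil w : prepend [::] w = w.
Proof. by apply/funext => i; rewrite /prepend nth_nil subn0. Qed.

Lemma prepend_cat a b w : prepend (a ++ b) w = prepend a (prepend b w).
Proof.
apply/funext => i; rewrite /prepend nth_cat size_cat subnDA.
by case: ltnP => ia; [exact: set_nth_default | rewrite [RHS]nth_default].
Qed.

Lemma prepend_inj a : injective (prepend a).
Proof. by move=> w v E; rewrite -(xdrop_prepend a w) E xdrop_prepend. Qed.

Lemma in_cone_prepend a w : in_cone a (prepend a w).
Proof. by rewrite /in_cone xtake_prepend. Qed.

Lemma in_coneP a x : reflect (exists w, x = prepend a w) (in_cone a x).
Proof.
apply: (iffP eqP) => [E|[w ->]]; last exact: xtake_prepend.
by exists (xdrop (size a) x); rewrite -[in RHS]E size_xtake prepend_xtake.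
Qed.

Lemma coneE a x : cone a x <-> in_cone a x.
Proof.
split=> [[w _ <-]|/in_coneP[w ->]]; [exact: in_cone_prepend | by exists w].
Qed.

Lemma in_cone_xtake n x : in_cone (xtake n x) x.
Proof. by rewrite /in_cone size_xtake. Qed.

Lemma in_cone_prefix a b x : prefix a b -> in_cone b x -> in_cone a x.
Proof. by move=> /prefixP[c ->] /in_coneP[w ->]; rewrite prepend_cat in_cone_prepend. Qed.

Lemma in_cone_comparable a b x : in_cone a x -> in_cone b x -> prefix a b || prefix b a.
Proof.
rewrite /in_cone => /eqP E /eqP F; rewrite !prefixE.
case: (leqP (size a) (size b)) => [le|/ltnW le].
  by rewrite -[X in take (size a) X]F take_xtake // E eqxx.
by rewrite -[X in take (size b) X]E take_xtake // F eqxx orbT.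
Qed.

Lemma incomp_in_cone a b x : incomp a b -> in_cone a x -> in_cone b x = false.
Proof.
move=> /andP[ab ba] ax; apply/negbTE/negP => /(in_cone_comparable ax).
by rewrite (negPf ab) (negPf ba).
Qed.

Lemma in_cone_prepend_prefix a c w :
  (size a <= size c)%N -> in_cone a (prepend c w) -> prefix a c.
Proof.
move=> ac /eqP E; rewrite prefixE -[X in take _ X](xtake_prepend c w).
by rewrite take_xtake // E.
Qed.

Lemma incompC a b : incomp a b = incomp b a.
Proof. by rewrite /incomp andbC. Qed.

Lemma incomp_catr a b c : incomp a b -> incomp a (b ++ c).
Proof.
move=> /andP[ab ba]; apply/andP; split.
  apply/negP => abc; have bbc := prefix_prefix b c.
  have := in_cone_comparable (in_cone_prefix abc (in_cone_prepend (b ++ c) (fun=> false)))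
    (in_cone_prefix bbc (in_cone_prepend (b ++ c) (fun=> false))).
  by rewrite (negPf ab) (negPf ba).
by apply: contra ba; exact: catl_prefix.
Qed.

Lemma incomp_cat2 a b c : incomp (a ++ b) (a ++ c) = incomp b c.
Proof. by rewrite /incomp !prefix_catr ?eqxx. Qed.

Lemma incomp_size a b : size a = size b -> a <> b -> incomp a b.
Proof.
move=> s ab; rewrite /incomp !prefixE s take_size -s take_size.
by rewrite (eq_sym b) andbb; apply/eqP.
Qed.

Lemma incomp_children a : incomp (a ++ [:: false]) (a ++ [:: true]).
Proof. by rewrite incomp_cat2. Qed.

Lemma incomp_disjoint a b : (forall x, in_cone a x -> in_cone b x -> False) -> incomp a b.
Proof.
move=> dj; apply/andP; split; apply/negP => /in_cone_prefix pr.
  by apply: (dj (prepend b (fun=> false))); [apply: pr|]; exact: in_cone_prepend.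
by apply: (dj (prepend a (fun=> false))); [|apply: pr]; exact: in_cone_prepend.
Qed.

Lemma prepend_addr_inj a b : (forall w, prepend a w = prepend b w) -> a = b.
Proof.
move=> E; wlog: a b E / (size a <= size b)%N.
  by move=> H; case: (leqP (size a) (size b)) => [|/ltnW] /H; [exact | move=> <-].
move=> ab; have ap : prefix a b.
  by have := in_cone_prepend a (fun=> false); rewrite E; exact: in_cone_prepend_prefix.
case/prefixP: ap => -[|c s] b_E; first by rewrite b_E cats0.
(* When [b] is [a] followed by [c] and further letters, a continuation starting with the other
   letter separates the two. *)
have := E (fun=> ~~ c); rewrite b_E prepend_cat => /prepend_inj /(congr1 (@^~ 0%N)).
by rewrite /prepend /=; case: c {b_E}.
Qed.

Lemma address_act_uniq g a b c : address_act g a b -> address_act g a c -> b = c.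
Proof. by move=> ab ac; apply: prepend_addr_inj => w; rewrite -ab -ac. Qed.

Lemma address_act_cat g a b c : address_act g a b -> address_act g (a ++ c) (b ++ c).
Proof. by move=> ab w; rewrite !prepend_cat. Qed.

Lemma address_act_comp g h a b c :
  address_act h a b -> address_act g b c -> address_act (g \o h) a c.
Proof. by move=> ab bc w; rewrite /= ab bc. Qed.

Lemma address_act_inv g h a b :
  cancel g h -> address_act g a b -> address_act h b a.
Proof. by move=> gh ab w; rewrite -ab gh. Qed.

Lemma in_cone_act g a b x : injective g -> address_act g a b -> in_cone b (g x) = in_cone a x.
Proof.
move=> gi ab; apply/in_coneP/in_coneP => -[w E]; exists w; last by rewrite E ab.
by apply: gi; rewrite E ab.
Qed.

Lemma incomp_act g a b a' b' : bijective g ->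
  address_act g a a' -> address_act g b b' -> incomp a b -> incomp a' b'.
Proof.
move=> [h gh hg] aa' bb' ab; apply: incomp_disjoint => x.
rewrite -(hg x) !(in_cone_act _ (can_inj gh) aa') (in_cone_act _ (can_inj gh) bb').
by move=> ia; rewrite (incomp_in_cone ab ia).
Qed.

(** * Maps that act on all sufficiently long addresses, and Thompson's group in these terms *)

Definition acts_at (g : cantor -> cantor) (N : nat) : Prop :=
  forall a : address, (N <= size a)%N -> exists b, address_act g a b.

Lemma acts_at_le g M N : (M <= N)%N -> acts_at g M -> acts_at g N.
Proof. by move=> MN gM a Na; apply: gM; apply: leq_trans Na. Qed.

Lemma acts_atW g N :
  (forall a : address, size a = N -> exists b, address_act g a b) -> acts_at g N.
Proof.
move=> gN a Na; have [|b gb] := gN (take N a); first by rewrite size_takel.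
by exists (b ++ drop N a); rewrite -[in X in address_act _ X](cat_take_drop N a);
  exact: address_act_cat.
Qed.

Definition words (n : nat) : seq address := [seq tval t | t : n.-tuple bool].

Lemma mem_words n (a : address) : (a \in words n) = (size a == n).
Proof.
apply/mapP/eqP => [[t _ ->]|sa]; first exact: size_tuple.
by exists (tcast sa (in_tuple a)); rewrite ?mem_enum ?val_tcast.
Qed.

Lemma words_uniq n : uniq (words n).
Proof. by rewrite map_inj_uniq ?enum_uniq //; exact: val_inj. Qed.

(** Letters beyond the first [N] are copied unchanged to the end of the image. *)
Lemma act_size_ge g N M : acts_at g N ->
  forall a b, (N + M <= size a)%N -> address_act g a b -> (M <= size b)%N.
Proof.
move=> gN a b sa ab; have [|c gc] := gN (take N a).
  by rewrite size_takel //; lia.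
have := address_act_cat (drop N a) gc; rewrite cat_take_drop => /(address_act_uniq ab) ->.
by rewrite size_cat size_drop; lia.
Qed.

Lemma acts_at_fun g N : acts_at g N ->
  exists f : address -> address, forall a, (N <= size a)%N -> address_act g a (f a).
Proof.
move=> gN; suff [f fP] : {f : address -> address &
    forall a, (N <= size a)%N -> address_act g a (f a)} by exists f.
apply: (@choice _ _ (fun a b => (N <= size a)%N -> address_act g a b)) => a.
case: (leqP N (size a)) => [sa|_]; last by exists a.
by have [b gb] := gN a sa; exists b.
Qed.

Lemma act_size_bound g N : acts_at g N ->
  exists B, forall a b, size a = N -> address_act g a b -> (size b <= B)%N.
Proof.
move=> gN.
have [f fP] := acts_at_fun gN.
exists (\max_(a <- words N) size (f a)) => a b sa ab.
rewrite (address_act_uniq ab (fP a (eq_leq (esym sa)))); apply: leq_bigmax_seq => //.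
by rewrite mem_words sa.
Qed.

(** The images of the cones of depth [N] cover the space and have addresses of length at most [B],
    so every address of length [B] extends one of these. *)
Lemma acts_at_inv g h N : acts_at g N -> cancel g h -> cancel h g ->
  exists M, acts_at h M.
Proof.
move=> gN gh hg; have [B BP] := act_size_bound gN.
exists B; apply: acts_atW => b sb.
pose x := prepend b (fun=> false); pose a := xtake N (h x).
have [|c ac] := gN a; first by rewrite size_xtake.
have cB : (size c <= size b)%N by rewrite sb; apply: (BP a) => //; rewrite size_xtake.
have : in_cone c x by rewrite -(hg x) (in_cone_act _ (can_inj gh) ac) in_cone_xtake.
move=> /(in_cone_prepend_prefix cB)/prefixP[d ->].
by exists (a ++ d); apply/(address_act_inv gh)/address_act_cat.
Qed.

Lemma thompsonV_acts g : thompsonV g -> exists N, acts_at g N.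
Proof.
move=> [n [a [b [[cova _ _] _ gab]]]]; exists (\max_i size (a i)); apply: acts_atW => c sc.
have : cover [set: 'I_n] (fun i => cone (a i)) (prepend c (fun=> false)) by rewrite cova.
move=> [i _ /coneE]/in_cone_prepend_prefix; rewrite sc leq_bigmax.
by move=> /(_ isT)/prefixP[d ->]; exists (b i ++ d); exact: address_act_cat.
Qed.

Lemma thompsonV_bij g : thompsonV g -> bijective g.
Proof.
move=> [n [a [b [[cova trva _] [covb trvb _] gab]]]].
have da x : exists i, in_cone (a i) x.
  have : cover [set: 'I_n] (fun i => cone (a i)) x by rewrite cova.
  by move=> [i _ /coneE]; exists i.
have db x : exists i, in_cone (b i) x.
  have : cover [set: 'I_n] (fun i => cone (b i)) x by rewrite covb.
  by move=> [i _ /coneE]; exists i.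
rewrite -setTT_bijective; split=> // [x y _ _ E|y _].
  have [i /in_coneP[w xE]] := da x; have [j /in_coneP[v yE]] := da y.
  have ij : i = j.
    apply: trvb => //; exists (g x); split; apply/coneE.
      by rewrite xE gab in_cone_prepend.
    by rewrite E yE gab in_cone_prepend.
  by move: E; rewrite xE yE !gab -ij => /prepend_inj ->.
have [i /in_coneP[w yE]] := db y; exists (prepend (a i) w) => //.
by rewrite gab yE.
Qed.

(** Trades the two partitions for a single depth. In the converse direction the source partition
    consists of all cones of depth [N]. *)
Lemma thompsonVP g : thompsonV g <-> bijective g /\ exists N, acts_at g N.
Proof.
split=> [gV|]; first by split; [exact: thompsonV_bij | exact: thompsonV_acts].
move=> [[h gh hg] [N gN]].
have [f fP] := acts_at_fun gN.
pose W (i : 'I_#|{: N.-tuple bool}|) : address := tval (enum_val i).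
have sW i : size (W i) = N by exact: size_tuple.
have fW i : address_act g (W i) (f (W i)) by apply: fP; rewrite sW.
have WP x : exists i, in_cone (W i) x.
  pose t := tcast (size_xtake N x) (in_tuple (xtake N x)).
  by exists (enum_rank t); rewrite /W enum_rankK val_tcast in_cone_xtake.
have Wtriv i j x : in_cone (W i) x -> in_cone (W j) x -> i = j.
  rewrite /in_cone !sW => /eqP E /eqP F; apply: enum_val_inj; apply: val_inj.
  by rewrite -[LHS]/(W i) -[RHS]/(W j) -E -F.
exists #|{: N.-tuple bool}|, W, (f \o W); split=> [||i w]; last exact: fW.
- split.
  + apply/seteqP; split => // x _; have [i xi] := WP x.
    by exists i => //; apply/coneE.
  + by move=> i j _ _ [x [/coneE xi /coneE xj]]; apply: Wtriv xi xj.
  + by move=> i _; exists (prepend (W i) (fun=> false)); apply/coneE; exact: in_cone_prepend.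
- split.
  + apply/seteqP; split => // x _; have [i xi] := WP (h x).
    by exists i => //; apply/coneE; rewrite -(hg x) (in_cone_act _ (can_inj gh) (fW i)).
  + move=> i j _ _ [x [/coneE + /coneE]]; rewrite -(hg x).
    by rewrite !(in_cone_act _ (can_inj gh) (fW _)); exact: Wtriv.
  + by move=> i _; exists (prepend (f (W i)) (fun=> false)); apply/coneE; exact: in_cone_prepend.
Qed.

Lemma thompsonV_id : thompsonV id.
Proof.
apply/thompsonVP; split; first by exists id.
by exists 0%N => a _; exists a.
Qed.

Lemma thompsonV_comp g h : thompsonV g -> thompsonV h -> thompsonV (g \o h).
Proof.
move=> /thompsonVP[gb [N gN]] /thompsonVP[hb [M hM]]; apply/thompsonVP.
split; first exact: bij_comp.
exists (M + N)%N => a sa; have [|b ab] := hM a; first lia.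
have [|c bc] := gN b; first exact: act_size_ge sa ab.
by exists c; exact: address_act_comp bc.
Qed.

Lemma thompsonV_inv g h : cancel g h -> cancel h g -> thompsonV g -> thompsonV h.
Proof.
move=> gh hg /thompsonVP[_ [N gN]]; apply/thompsonVP; split; first by exists g.
exact: acts_at_inv gN gh hg.
Qed.

Lemma thompsonV_group : group_of_maps thompsonV.
Proof.
split; [exact: thompsonV_id | exact: thompsonV_comp | move=> g gV].
have [h gh hg] := thompsonV_bij gV.
by exists h; [exact: thompsonV_inv gV | split].
Qed.

(** * Transpositions of cones generate Thompson's group *)

Definition swap (a b : address) (x : cantor) : cantor :=
  if in_cone a x then prepend b (xdrop (size a) x)
  else if in_cone b x then prepend a (xdrop (size b) x) else x.

Lemma swap_l a b : address_act (swap a b) a b.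
Proof. by move=> w; rewrite /swap in_cone_prepend xdrop_prepend. Qed.

Lemma swap_r a b : incomp a b -> address_act (swap a b) b a.
Proof.
rewrite incompC => ab w.
by rewrite /swap (incomp_in_cone ab (in_cone_prepend b w)) in_cone_prepend xdrop_prepend.
Qed.

Lemma swap_out a b x : ~~ in_cone a x -> ~~ in_cone b x -> swap a b x = x.
Proof. by rewrite /swap => /negPf -> /negPf ->. Qed.

Lemma swap_id a : swap a a = id.
Proof.
apply/funext => x; have [/in_coneP[w ->]|ax] := boolP (in_cone a x); first by rewrite swap_l.
by rewrite swap_out.
Qed.

Lemma swap_fix a b c : incomp a c -> incomp b c -> address_act (swap a b) c c.
Proof.
rewrite incompC => ca; rewrite incompC => cb w; have cw := in_cone_prepend c w.
by rewrite swap_out ?(incomp_in_cone ca cw) ?(incomp_in_cone cb cw).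
Qed.

Lemma swapK a b : incomp a b -> involutive (swap a b).
Proof.
move=> ab x; have [/in_coneP[w ->]|ax] := boolP (in_cone a x); first by rewrite swap_l swap_r.
have [/in_coneP[w ->]|bx] := boolP (in_cone b x); first by rewrite swap_r // swap_l.
by rewrite !swap_out.
Qed.

Lemma swap_bij a b : incomp a b -> bijective (swap a b).
Proof. by move=> /swapK K; exists (swap a b). Qed.

Lemma swapC a b : incomp a b -> swap a b = swap b a.
Proof.
move=> ab; apply/funext => x.
have [/in_coneP[w ->]|ax] := boolP (in_cone a x); first by rewrite swap_l swap_r // incompC.
have [/in_coneP[w ->]|bx] := boolP (in_cone b x); first by rewrite swap_r // swap_l.
by rewrite !swap_out.
Qed.

Lemma swap_conj h a b a' b' : bijective h -> incomp a b ->
  address_act h a a' -> address_act h b b' -> h \o swap a b = swap a' b' \o h.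
Proof.
move=> hb ab aa' bb'; have hi := bij_inj hb.
have ab' := incomp_act hb aa' bb' ab; apply/funext => x /=.
have [/in_coneP[w ->]|ax] := boolP (in_cone a x); first by rewrite swap_l aa' bb' swap_l.
have [/in_coneP[w ->]|bx] := boolP (in_cone b x); first by rewrite swap_r // aa' bb' swap_r.
by rewrite !swap_out // ?(in_cone_act _ hi aa') ?(in_cone_act _ hi bb').
Qed.

Lemma prepend_head w : w = prepend [:: w 0%N] (xdrop 1 w).
Proof. by rewrite -[LHS](prepend_xtake 1). Qed.

(** Lets a transposition be rebuilt from deeper ones; this later gives the step from children to
    parents for [swap_type]. *)
Lemma swap_split a b : incomp a b ->
  swap (a ++ [:: false]) (b ++ [:: false]) \o swap (a ++ [:: true]) (b ++ [:: true])
  = swap a b.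
Proof.
move=> ab; have i c d : incomp (a ++ c) (b ++ d).
  by apply: incomp_catr; rewrite incompC; apply: incomp_catr; rewrite incompC.
have ac c : incomp (a ++ [:: c]) (a ++ [:: ~~ c]) by rewrite incomp_cat2; case: c.
have bc c : incomp (b ++ [:: c]) (b ++ [:: ~~ c]) by rewrite incomp_cat2; case: c.
apply/funext => x /=.
have [/in_coneP[w ->]|ax] := boolP (in_cone a x).
  rewrite swap_l (prepend_head w) -!prepend_cat; case: (w _).
    by rewrite swap_l swap_fix // incomp_children.
  by rewrite swap_fix ?swap_l // incompC // incomp_children.
have [/in_coneP[w ->]|bx] := boolP (in_cone b x).
  rewrite swap_r // (prepend_head w) -!prepend_cat; case: (w _).
    by rewrite swap_r // swap_fix // ?incomp_children // incompC.
  by rewrite swap_fix ?swap_r // incompC ?incomp_children.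
have nx c d : ~~ in_cone c x -> ~~ in_cone (c ++ d) x.
  by apply: contra; apply/in_cone_prefix/prefix_prefix.
by rewrite !swap_out ?nx.
Qed.

Lemma swap_acts a b : incomp a b ->
  forall c, (maxn (size a) (size b) <= size c)%N ->
  [\/ address_act (swap a b) c c,
      exists2 d, c = a ++ d & address_act (swap a b) c (b ++ d) |
      exists2 d, c = b ++ d & address_act (swap a b) c (a ++ d)].
Proof.
move=> ab c; rewrite geq_max => /andP[ac bc].
have [/prefixP[d ->]|nac] := boolP (prefix a c).
  by apply: Or32; exists d => //; apply/address_act_cat/swap_l.
have [/prefixP[d ->]|nbc] := boolP (prefix b c).
  by apply: Or33; exists d => //; apply/address_act_cat/swap_r.
have incompW d : (size d <= size c)%N -> ~~ prefix d c -> incomp d c.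
  move=> dc ndc; rewrite /incomp ndc; apply: contra ndc => /prefixP[e dE].
  move: dc; rewrite dE size_cat -[X in (_ <= X)%N -> _]addn0 leq_add2l leqn0 size_eq0.
  by move=> /eqP ->; rewrite cats0 prefix_refl.
by apply: Or31; apply: swap_fix; apply: incompW.
Qed.

Lemma swap_thompsonV a b : incomp a b -> thompsonV (swap a b).
Proof.
move=> ab; apply/thompsonVP; split; first exact: swap_bij.
exists (maxn (size a) (size b)) => c /(swap_acts ab)[cc|[d _ cd]|[d _ cd]].
- by exists c.
- by exists (b ++ d).
- by exists (a ++ d).
Qed.

(* The cones of the members of a code partition the Cantor space. *)
Definition is_code (L : seq address) : Prop :=
  forall x, count (in_cone^~ x) L = 1%N.

Lemma is_code_nil : is_code [:: [::]].
Proof. by move=> x. Qed.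

Lemma is_code_perm L M : perm_eq L M -> is_code L -> is_code M.
Proof. by move=> /permP LM cL x; rewrite -LM cL. Qed.

Lemma code_cover L x : is_code L -> exists2 a, a \in L & in_cone a x.
Proof. by move=> cL; apply/hasP; rewrite has_count cL. Qed.

Lemma code_uniq_in_cone L a b x :
  is_code L -> a \in L -> b \in L -> in_cone a x -> in_cone b x -> a = b.
Proof.
move=> cL aL bL ax bx; apply/eqP/negPn/negP => ab.
have := cL x; rewrite (permP (perm_to_rem aL)) /= ax.
have bR : b \in rem a L.
  by move: bL; rewrite (perm_mem (perm_to_rem aL)) inE eq_sym (negPf ab).
by rewrite (permP (perm_to_rem bR)) /= bx.
Qed.

Lemma code_incomp L a b :
  is_code L -> a \in L -> b \in L -> a != b -> incomp a b.
Proof.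
move=> cL aL bL ab; apply: incomp_disjoint => x ax bx.
by move: ab; rewrite (code_uniq_in_cone cL aL bL ax bx) eqxx.
Qed.

Lemma code_uniq L : is_code L -> uniq L.
Proof.
move=> cL; apply: count_mem_uniq => a.
have [aL|aL] := boolP (a \in L); last by rewrite (count_memPn aL).
apply/eqP; rewrite eqn_leq -has_count has_pred1 aL andbT /=.
rewrite -(cL (prepend a (fun=> false))); apply: sub_count => b /eqP ->.
exact: in_cone_prepend.
Qed.

Lemma in_cone_split u x :
  (in_cone u x : nat) = (in_cone (u ++ [:: false]) x + in_cone (u ++ [:: true]) x)%N.
Proof.
have [/in_coneP[w ->]|ux] := boolP (in_cone u x); last first.
  have nx d : in_cone (u ++ d) x = false.
    by apply: contraNF ux; apply/in_cone_prefix/prefix_prefix.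
  by rewrite !nx.
rewrite (prepend_head w) -prepend_cat; have := incomp_children u.
case: (w _) => ab; rewrite in_cone_prepend; last by rewrite (incomp_in_cone ab) ?in_cone_prepend.
by rewrite incompC in ab; rewrite (incomp_in_cone ab) ?in_cone_prepend.
Qed.

Lemma code_split u L :
  is_code (u :: L) <-> is_code ((u ++ [:: false]) :: (u ++ [:: true]) :: L).
Proof.
by split=> cL x; have := cL x; rewrite /= (in_cone_split u) addnA.
Qed.

(** A member of maximal length must have its sibling in the code as well, and the two can be
    merged. *)
Lemma code_contract L : is_code L -> L = [:: [::]] \/
  exists u M, perm_eq L ((u ++ [:: false]) :: (u ++ [:: true]) :: M) /\ is_code (u :: M).
Proof.
move=> cL; have [a0 a0L _] := code_cover (fun=> false) cL.
have [a aL amax] : exists2 a, a \in L & forall b, b \in L -> (size b <= size a)%N.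
  have i0 : (index a0 L < size L)%N by rewrite index_mem.
  have [i _ imax] := @arg_maxnP _ (Ordinal i0) xpredT (fun i => size (nth [::] L i)) isT.
  exists (nth [::] L i); first by rewrite mem_nth.
  move=> b bL; have iL : (index b L < size L)%N by rewrite index_mem.
  by have /= := imax (Ordinal iL) isT; rewrite nth_index.
case: (lastP a) aL amax => [nL _|u c uL umax].
  (* The empty address covers every point and leaves no room for a second member. *)
  left; have cN := cL (fun=> false); rewrite (permP (perm_to_rem nL)) /= in cN.
  have R0 b : b \notin rem [::] L.
    apply/negP => bR; have := cL (prepend b (fun=> false)).
    rewrite (permP (perm_to_rem nL)) /= (permP (perm_to_rem bR)) /= in_cone_prepend.
    by rewrite /in_cone.
  have : perm_eq L [:: [::]].
    rewrite (perm_trans (perm_to_rem nL)) //.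
    by case: (rem _ _) R0 => // b s /(_ b); rewrite inE eqxx.
  by move=> /perm_small_eq ->.
right; rewrite -cats1 in uL umax.
(* The member [d] meeting the sibling's cone is no longer than the sibling, hence a prefix of it. A
   proper prefix would be a prefix of [u], so its cone would contain that of [u ++ [:: c]]. *)
have [d dL dx] := code_cover (prepend (u ++ [:: ~~ c]) (fun=> false)) cL.
have dE : d = u ++ [:: ~~ c].
  have : prefix d (u ++ [:: ~~ c]).
    by apply: in_cone_prepend_prefix dx; have := umax d dL; rewrite !size_cat.
  rewrite cats1 => /prefixP[s]; case: (lastP s) => [->|s' e]; first by rewrite cats0.
  rewrite -rcons_cat => /rcons_inj[uE _]; have du : prefix d u by rewrite uE prefix_prefix.
  suff dua : d = u ++ [:: c].
    by have := size_prefix du; rewrite dua size_cat addn1 ltnn.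
  apply: (code_uniq_in_cone cL dL uL) (in_cone_prepend _ (fun=> false)).
  by apply: in_cone_prefix (in_cone_prepend _ (fun=> false)); exact: prefix_catl.
subst d; exists u, (rem (u ++ [:: ~~ c]) (rem (u ++ [:: c]) L)).
have p1 : perm_eq L
    ((u ++ [:: c]) :: (u ++ [:: ~~ c]) :: rem (u ++ [:: ~~ c]) (rem (u ++ [:: c]) L)).
  rewrite (perm_trans (perm_to_rem uL)) // perm_cons; apply: perm_to_rem.
  move: dL; rewrite (perm_mem (perm_to_rem uL)) inE eqseq_cat // eqxx.
  by case: (c).
have p2 : perm_eq L ((u ++ [:: false]) :: (u ++ [:: true]) ::
    rem (u ++ [:: ~~ c]) (rem (u ++ [:: c]) L)).
  case: (c) p1 => // p1; apply: perm_trans p1 _.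
  by apply/permP => q /=; rewrite addnCA.
by split=> //; apply/code_split/(is_code_perm p2).
Qed.

Lemma code_map L g f : is_code L -> bijective g ->
  (forall a, a \in L -> address_act g a (f a)) -> is_code (map f L).
Proof.
move=> cL [h gh hg] gf x; rewrite -(cL (h x)) count_map; apply: eq_in_count => a aL /=.
by rewrite -(in_cone_act _ (can_inj gh) (gf a aL)) hg.
Qed.

(** One transposition takes [a] to [c], a second takes the image of [b] to [d]; the second leaves
    [c] alone because [c] differs from both of its addresses. *)
Lemma code_swaps (H : set (cantor -> cantor)) L a b c d :
  group_of_maps H -> (forall u v, incomp u v -> H (swap u v)) -> is_code L ->
  a \in L -> b \in L -> c \in L -> d \in L -> a != b -> c != d ->
  exists s, [/\ H s, bijective s, address_act s a c, address_act s b d &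
    forall e, e \in L -> exists2 e', e' \in L & address_act s e e'].
Proof.
move=> [Hid Hc _] Hs cL aL bL cL' dL ab cd.
pose tr p q e := if e == p then q else if e == q then p else e : address.
have trL p q e : p \in L -> q \in L -> e \in L -> tr p q e \in L.
  by rewrite /tr; case: ifP => // _; case: ifP.
have swH p q : p \in L -> q \in L -> H (swap p q) /\ bijective (swap p q).
  move=> pL qL; case: (eqVneq p q) => [->|pq].
    by rewrite swap_id; split=> //; exists id.
  have pq' := code_incomp cL pL qL pq.
  by split; [exact: Hs | exact: swap_bij].
have swA p q e : p \in L -> q \in L -> e \in L -> address_act (swap p q) e (tr p q e).
  move=> pL qL eL; case: (eqVneq p q) => [->|pq].
    by rewrite swap_id /tr; case: eqP => // ->.
  have pq' := code_incomp cL pL qL pq.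
  rewrite /tr; case: eqVneq => [->|ep]; first exact: swap_l.
  case: eqVneq => [->|eq]; first exact: swap_r.
  by apply: swap_fix; [apply: (code_incomp cL) | apply: (code_incomp cL)]; rewrite // eq_sym.
have b'L := trL _ _ _ aL cL' bL.
have [H1 B1] := swH _ _ aL cL'; have [H2 B2] := swH _ _ b'L dL.
exists (swap (tr a c b) d \o swap a c); split.
- exact: Hc.
- exact: bij_comp.
- apply: address_act_comp (swA _ _ _ aL cL' aL) _.
  have := swA _ _ _ b'L dL cL'; rewrite [tr a c a]/tr eqxx.
  suff cb' : c != tr a c b by rewrite [tr _ d c]/tr (negPf cb') (negPf cd).
  by rewrite /tr (eq_sym b) (negPf ab); case: (eqVneq b c) => [<-|]; rewrite eq_sym.
- by apply: address_act_comp (swA _ _ _ aL cL' bL) _; exact: swap_l.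
- move=> e eL; exists (tr (tr a c b) d (tr a c e)); first by rewrite !trL.
  by apply: address_act_comp (swA _ _ _ aL cL' eL) _; apply: swA; rewrite ?trL.
Qed.

(** Induction on the size of a code on which [g] acts. Both the code and its image contain a sibling
    pair; permuting the image code so that one pair is sent to the other makes [g] act on the merged
    address. *)
Lemma swaps_generate (H : set (cantor -> cantor)) :
  group_of_maps H -> (forall a b, incomp a b -> H (swap a b)) -> thompsonV `<=` H.
Proof.
move=> gH Hs g /thompsonVP[gb [N gN]].
have : exists L, is_code L /\ forall a, a \in L -> exists b, address_act g a b.
  exists (words N); split=> [x|a]; last by rewrite mem_words => /eqP sa; apply: gN; rewrite sa.
  rewrite (@eq_in_count _ _ (pred1 (xtake N x))); last first.
    by move=> a; rewrite mem_words /in_cone /= eq_sym => /eqP ->.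
  by rewrite count_uniq_mem ?words_uniq // mem_words size_xtake eqxx.
move=> [L [cL gL]]; move: {2}(size L) (leqnn (size L)) => n.
elim: n g L gb cL gL {N gN} => [|n IH] g L gb cL gL sL.
  by have [a] := code_cover (fun=> false) cL; case: L sL {cL gL}.
have [f fP] : exists f : address -> address, forall a, a \in L -> address_act g a (f a).
  suff [f fP] : {f : address -> address & forall a, a \in L -> address_act g a (f a)}
    by exists f.
  apply: (@choice _ _ (fun a b => a \in L -> address_act g a b)) => a.
  by case: (boolP (a \in L)) => [/gL[b ab]|_]; [exists b | exists a].
have cF := code_map cL gb fP.
have [LE|[u [M [pL cM]]]] := code_contract cL.
  have [f0|[v [K [pF _]]]] := code_contract cF; last first.
    by have := perm_size pF; rewrite size_map LE.
  move: f0 (fP [::]); rewrite LE inE eqxx => -[->] /(_ isT) gid.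
  suff -> : g = id by case: gH.
  by apply/funext => x; have := gid x; rewrite !prepend_nil.
have sM : (size M).+2 = size L by rewrite (perm_size pL).
have [F0|[v [K [pF _]]]] := code_contract cF.
  by have := size_map f L; rewrite F0 -sM.
set u0 := u ++ [:: false] in pL; set u1 := u ++ [:: true] in pL.
set v0 := v ++ [:: false] in pF; set v1 := v ++ [:: true] in pF.
have u0L : u0 \in L by rewrite (perm_mem pL) !inE eqxx.
have u1L : u1 \in L by rewrite (perm_mem pL) !inE eqxx orbT.
have v0F : v0 \in map f L by rewrite (perm_mem pF) !inE eqxx.
have v1F : v1 \in map f L by rewrite (perm_mem pF) !inE eqxx orbT.
have u01 : u0 != u1 by rewrite eqseq_cat // eqxx.
have v01 : v0 != v1 by rewrite eqseq_cat // eqxx.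
have f01 : f u0 != f u1.
  have := incomp_act gb (fP _ u0L) (fP _ u1L) (code_incomp cL u0L u1L u01).
  by apply: contraTneq => ->; rewrite /incomp prefix_refl.
have [s [Hs' sb s0 s1 sF]] :=
  code_swaps gH Hs cF (map_f f u0L) (map_f f u1L) v0F v1F f01 v01.
have sg : H (s \o g).
  apply: (IH _ (u :: M)) => //; [exact: bij_comp | | by move: sL; rewrite -sM].
  move=> a; rewrite inE => /orP[/eqP ->|aM].
    exists v => w; rewrite (prepend_head w) -!prepend_cat /=.
    by case: (w _); [rewrite fP | rewrite fP].
  have aL : a \in L by rewrite (perm_mem pL) !inE aM !orbT.
  have [e' _ ae'] := sF _ (map_f f aL); exists e'.
  exact: address_act_comp (fP a aL) ae'.
case: gH => _ Hc /(_ _ Hs')[s' Hs'' [ss' s's]].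
suff -> : g = s' \o (s \o g) by apply: Hc.
by apply/funext => x /=; rewrite ss'.
Qed.

(** * Stabilizers of simple type systems are maximal *)

Definition strongly_connected (R : address -> address -> Prop) : Prop :=
  forall a b, exists c, R (a ++ c) b.

Section TypeSystem.
Variable R : address -> address -> Prop.
Hypothesis tsR : type_system R.

Lemma type_refl a : R a a.
Proof. by case: tsR => [[r _ _] _]; exact: r. Qed.

Lemma type_sym a b : R a b -> R b a.
Proof. by case: tsR => [[_ s _] _]; exact: s. Qed.

Lemma type_trans b a c : R a b -> R b c -> R a c.
Proof. by case: tsR => [[_ _ t] _]; exact: t. Qed.

Lemma type_cat a b c : R a b -> R (a ++ c) (b ++ c).
Proof.
elim: c a b => [|c s IH] a b ab; first by rewrite !cats0.
rewrite -!cat_rcons; apply: IH; case: tsR => _ /(_ a b)[/(_ ab)[]].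
by case: c.
Qed.

Lemma type_children a b :
  R (a ++ [:: false]) (b ++ [:: false]) -> R (a ++ [:: true]) (b ++ [:: true]) -> R a b.
Proof. by rewrite !cats1 => f t; case: tsR => _ /(_ a b)[_]; apply. Qed.

Lemma type_ext n a b :
  (forall s, size s = n -> R (a ++ s) (b ++ s)) -> R a b.
Proof.
elim: n => [|n IH] Rs; first by have := Rs [::] erefl; rewrite !cats0.
apply: IH => s sn; apply: type_children; rewrite -!catA; apply: Rs;
  by rewrite size_cat addn1 sn.
Qed.

(** A finite set of addresses has bounded length, and only finitely many addresses are shorter than
    a given length. *)
Lemma stabilizerVP g : stabilizerV R g <-> thompsonV g /\
  exists N, forall a b a' b', (N <= size a)%N -> (N <= size b)%N ->
    address_act g a a' -> address_act g b b' -> (R a b <-> R a' b').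
Proof.
split=> [[gV [W [cW _ RW]]]|[gV [N NP]]]; split=> //.
  have [s sE] : exists s : seq address, ~` W = [set` s] by apply/finite_seqP.
  have sW a : ((\max_(b <- s) size b).+1 <= size a)%N -> W a.
    move=> sa; apply: contrapT => nW; have : (~` W) a by [].
    rewrite sE /= => aS; have := @leq_bigmax_seq _ s xpredT (@size bool) a aS isT.
    by rewrite leqNgt sa.
  exists (\max_(b <- s) size b).+1 => a b a' b' sa sb.
  by apply: RW; exact: sW.
have /thompsonVP[_ [M gM]] := gV.
exists [set a : address | (maxn M N <= size a)%N]; split.
- apply: (@sub_finite_set _ _ [set` flatten [seq words i | i <- iota 0 (maxn M N)]]).
    move=> a /= /negP; rewrite -ltnNge => sa; apply/flattenP.
    exists (words (size a)); last by rewrite mem_words.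
    by apply: map_f; rewrite mem_iota.
  exact: finite_seq.
- by move=> a /=; rewrite geq_max => /andP[sa _]; exact: gM.
- move=> a b a' b' /=; rewrite !geq_max => /andP[_ sa] /andP[_ sb].
  exact: NP.
Qed.

Lemma type_preserving_stabilizerV g : thompsonV g ->
  (exists N, forall a a', (N <= size a)%N -> address_act g a a' -> R a a') ->
  stabilizerV R g.
Proof.
move=> gV [N Rc]; apply/stabilizerVP; split=> //.
exists N => c d c' d' sc sd /(Rc _ _ sc) cc' /(Rc _ _ sd) dd'.
split=> [cd|cd'].
  by apply: type_trans dd'; apply: type_trans cd; exact: type_sym.
by apply: type_trans cc' _; apply: type_trans cd' _; exact: type_sym.
Qed.

Lemma swap_stabilizerV a b : R a b -> incomp a b -> stabilizerV R (swap a b).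
Proof.
move=> Rab ab; apply: type_preserving_stabilizerV; first exact: swap_thompsonV.
exists (maxn (size a) (size b)) => c c' /(swap_acts ab)[cc|[d -> cd]|[d -> cd]] /address_act_uniq.
- by move=> /(_ _ cc) ->; exact: type_refl.
- by move=> /(_ _ cd) ->; exact: type_cat.
- by move=> /(_ _ cd) ->; apply/type_cat/type_sym.
Qed.

Lemma stabilizerV_group : group_of_maps (stabilizerV R).
Proof.
split.
- apply/stabilizerVP; split; first exact: thompsonV_id.
  exists 0%N => a b a' b' _ _ aa bb.
  have idA c : address_act id c c by [].
  by rewrite -(address_act_uniq (idA a) aa) -(address_act_uniq (idA b) bb).
- move=> g h /stabilizerVP[gV [N gN]] /stabilizerVP[hV [M hM]]; apply/stabilizerVP.
  split; first exact: thompsonV_comp.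
  have /thompsonVP[_ [K hK]] := hV; have /thompsonVP[_ [K' gK]] := gV.
  (* At most [K] letters are lost under [h], and [K' + N] must remain for [g]; [M] is the threshold
     of [h] itself. *)
  exists (K + (K' + N) + M)%N => a b a' b' sa sb.
  have [|a1 aa] := hK a; first lia.
  have [|b1 bb] := hK b; first lia.
  have sa1 := act_size_ge hK (leq_trans (leq_addr M _) sa) aa.
  have sb1 := act_size_ge hK (leq_trans (leq_addr M _) sb) bb.
  have [|a2 aa2] := gK a1; first lia.
  have [|b2 bb2] := gK b1; first lia.
  move=> /(address_act_uniq (address_act_comp aa aa2)) <-.
  move=> /(address_act_uniq (address_act_comp bb bb2)) <-.
  rewrite (hM a b a1 b1) //; [|lia|lia].
  by apply: gN => //; lia.
- move=> g /stabilizerVP[gV [N gN]].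
  have [_ _ /(_ _ gV)[h hV [gh hg]]] := thompsonV_group.
  exists h; last by split.
  apply/stabilizerVP; split=> //; have /thompsonVP[_ [K hK]] := hV.
  exists (K + N)%N => a b a' b' sa sb aa bb.
  have sa' := act_size_ge hK sa aa; have sb' := act_size_ge hK sb bb.
  by split=> [ab|ab']; apply/(gN a' b' a b) => //; exact: address_act_inv hg _.
Qed.

Hypothesis scR : strongly_connected R.

(* There are eight cones of depth 3, so seven addresses leave one of them free. *)
Lemma fresh_address (L : seq address) M b :
  (forall l, l \in L -> (3 <= size l)%N) -> (size L < 8)%N ->
  exists a, [/\ R a b, (M <= size a)%N, (3 <= size a)%N & forall l, l \in L -> incomp a l].
Proof.
move=> L3 sL; have [d d3 dL] : exists2 d, size d = 3%N & d \notin map (take 3) L.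
  apply: contrapT => nd; suff : (8 <= size (map (take 3) L))%N.
    by rewrite size_map leqNgt sL.
  have <- : size (words 3) = 8 by rewrite size_map -cardE card_tuple card_bool.
  apply: uniq_leq_size (words_uniq 3) _ => d; rewrite mem_words => /eqP d3.
  by apply/negPn/negP => dL; apply: nd; exists d.
have [c cb] := scR (d ++ nseq M false) b.
exists (d ++ nseq M false ++ c); split.
- by rewrite catA.
- by rewrite !size_cat size_nseq addnCA leq_addr.
- by rewrite size_cat d3.
- move=> l lL; rewrite -(cat_take_drop 3 l); apply: incomp_catr; rewrite incompC.
  apply: incomp_catr; apply: incomp_size; first by rewrite size_takel ?L3.
  by move=> E; move: dL; rewrite -E map_f.
Qed.


End TypeSystem.

Lemma group_swap_conj (H : set (cantor -> cantor)) h a b a' b' :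
  group_of_maps H -> H h -> bijective h -> incomp a b ->
  address_act h a a' -> address_act h b b' -> H (swap a b) -> H (swap a' b').
Proof.
move=> [_ Hc Hi] Hh hb ab aa bb Hab; have [k Hk [hk kh]] := Hi _ Hh.
suff -> : swap a' b' = h \o swap a b \o k by apply: (Hc) => //; exact: Hc.
by rewrite (swap_conj hb ab aa bb); apply/funext => x /=; rewrite kh.
Qed.

(** * Type systems arising from overgroups of a stabilizer *)

Section Maximality.
Variables (R : address -> address -> Prop) (H : set (cantor -> cantor)).
Hypotheses (tsR : type_system R) (scR : strongly_connected R).
Hypotheses (gH : group_of_maps H) (HV : H `<=` thompsonV).
Hypothesis RH : stabilizerV R `<=` H.

Let swapH a b : R a b -> incomp a b -> H (swap a b).
Proof. by move=> ab i; apply/RH/swap_stabilizerV. Qed.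

(** Conjugation by [swap a c], which lies in [H] since [a] and [c] have the same type. *)
Let moveL a b c : R a c -> incomp a b -> incomp a c -> incomp b c ->
  H (swap a b) -> H (swap c b).
Proof.
move=> ac iab iac ibc; apply: (group_swap_conj gH (swapH ac iac) (swap_bij iac) iab) => //.
  exact: swap_l.
by apply: swap_fix => //; rewrite incompC.
Qed.

Let moveR a b c : R b c -> incomp a b -> incomp a c -> incomp b c ->
  H (swap a b) -> H (swap a c).
Proof.
move=> bc iab iac ibc; rewrite swapC // => Hba.
by rewrite swapC //; apply: moveL Hba => //; rewrite incompC.
Qed.

(** Quantifying over all disjoint representatives makes the relation depend on types only. The bound
    3 is the one under which [fresh_address] finds room. *)
Definition swap_type (a b : address) : Prop := forall a' b', R a' a -> R b' b ->
  (3 <= size a')%N -> (3 <= size b')%N -> incomp a' b' -> H (swap a' b').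

(** One transposition suffices. The pair [a], [b] is moved to [c], [d] one cone at a time through
    fresh cones [e], [f], because the old cones may overlap the new ones. *)
Let swap_typeI a b : (3 <= size a)%N -> (3 <= size b)%N -> incomp a b ->
  H (swap a b) -> swap_type a b.
Proof.
move=> sa sb iab Hab c d ca db sc sd icd.
have [|//|e [eA _ se ei]] := @fresh_address R scR [:: a; b; c; d] 0 a.
  by move=> l; rewrite !inE => /or4P[] /eqP ->.
have [|//|f [fB _ sf fi]] := @fresh_address R scR [:: a; b; c; d; e] 0 b.
  by move=> l; rewrite !inE => /or4P[||/eqP ->|/orP[]] // /eqP ->.
have iE l : l \in [:: a; b; c; d] -> incomp l e by move=> /ei; rewrite incompC.
have iF l : l \in [:: a; b; c; d; e] -> incomp l f by move=> /fi; rewrite incompC.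
have s1 : H (swap e b).
  by apply: moveL Hab => //; [exact: type_sym | apply: iE | apply: iE]; rewrite !inE eqxx ?orbT.
have s2 : H (swap e f).
  apply: moveR s1 => //; first exact: type_sym.
  - by apply: ei; rewrite !inE eqxx ?orbT.
  - by apply: iF; rewrite !inE eqxx ?orbT.
  - by apply: iF; rewrite !inE eqxx ?orbT.
have s3 : H (swap c f).
  apply: moveL s2 => //.
  - by apply: type_trans eA _ => //; exact: type_sym.
  - by apply: iF; rewrite !inE eqxx ?orbT.
  - by apply: ei; rewrite !inE eqxx ?orbT.
  - by apply: fi; rewrite !inE eqxx ?orbT.
apply: moveR s3 => //.
- by apply: type_trans fB _ => //; exact: type_sym.
- by apply: iF; rewrite !inE eqxx ?orbT.
- by apply: fi; rewrite !inE eqxx ?orbT.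
Qed.

(** Transitivity conjugates one transposition by another through a fresh intermediate cone. Children
    are related by conjugating with a transposition of the parents, and parents by [swap_split]. *)
Lemma swap_type_type_system : type_system swap_type.
Proof.
have sym a b : swap_type a b -> swap_type b a.
  move=> ab b' a' bb aa sb sa i; rewrite swapC //; apply: ab => //.
  by rewrite incompC.
split; first split.
- by move=> a a' b' aa bb _ _; apply: swapH; apply: type_trans aa _ => //; exact: type_sym.
- exact: sym.
- move=> a b c ab bc a' c' aa cc sa sc i.
  have [|//|b' [bb _ sb bi]] := @fresh_address R scR [:: a'; c'] 0 b.
    by move=> l; rewrite !inE => /orP[] /eqP ->.
  have ba : incomp b' a' by apply: bi; rewrite inE eqxx.
  have bc' : incomp b' c' by apply: bi; rewrite !inE eqxx orbT.
  have Hab : H (swap a' b') by apply: ab => //; rewrite incompC.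
  have Hbc : H (swap b' c') by apply: bc.
  apply: (group_swap_conj gH Hbc (swap_bij bc') _ _ _ Hab); first by rewrite incompC.
    by apply: swap_fix; rewrite // incompC.
  exact: swap_l.
move=> a b; rewrite -!cats1; split=> [ab|[ab0 ab1] a' b' aa bb sa sb i].
- have child c : swap_type (a ++ [:: c]) (b ++ [:: c]).
    have [//|//|A [AA _ sA _]] := @fresh_address R scR [::] 0 a.
    have [|//|B [BB _ sB Bi]] := @fresh_address R scR [:: A] 0 b.
      by move=> l; rewrite inE => /eqP ->.
    have iBA : incomp B A by apply: Bi; rewrite inE.
    have HAB : H (swap A B) by apply: ab => //; rewrite incompC.
    move=> a' b' aa bb sa sb i.
    have [|//|a2 [a2a _ sa2 a2i]] := @fresh_address R scR [:: A; B] 0 (a ++ [:: c]).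
      by move=> l; rewrite !inE => /orP[] /eqP ->.
    have a2A : incomp a2 A by apply: a2i; rewrite !inE eqxx.
    have a2B : incomp a2 B by apply: a2i; rewrite !inE eqxx orbT.
    (* The address [a2] has the type of [A ++ [:: c]] and is fixed by [swap A B], which carries [A
       ++ [:: c]] to [B ++ [:: c]]. *)
    have s1 : H (swap (A ++ [:: c]) a2).
      apply: swapH; last by rewrite incompC; exact: incomp_catr.
      by apply: (type_trans tsR) (type_sym tsR a2a); exact: type_cat.
    have s2 : H (swap (B ++ [:: c]) a2).
      apply: (group_swap_conj gH HAB (swap_bij _) _ _ _ s1).
      - by rewrite incompC.
      - by rewrite incompC; exact: incomp_catr.
      - exact/address_act_cat/swap_l.
      - by apply: swap_fix; rewrite incompC.
    have iB2 : incomp (B ++ [:: c]) a2 by rewrite incompC; exact: incomp_catr.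
    have sBc : (3 <= size (B ++ [:: c]))%N by rewrite size_cat; lia.
    have := swap_typeI sBc sa2 iB2 s2; move/sym; apply => //.
      by apply: (type_trans tsR) aa _; exact: type_sym.
    apply: (type_trans tsR) bb _; apply: (type_sym tsR); exact: type_cat.
  by split; exact: child.
- rewrite -swap_split //.
  have ic c : incomp (a' ++ [:: c]) (b' ++ [:: c]).
    by apply: incomp_catr; rewrite incompC; apply: incomp_catr; rewrite incompC.
  by case: gH => _ Hc _; apply: Hc; [apply: ab0 | apply: ab1] => //;
    rewrite ?size_cat; by [apply: type_cat | lia].
Qed.

Lemma swap_type_universal : universal_relation swap_type -> H = thompsonV.
Proof.
move=> u; apply/seteqP; split=> //; apply: swaps_generate gH _ => a b.
(* Universality only covers cones of depth at least 3; a shallower pair is split up to three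
   times. *)
have sub3 n c d : (3 <= size c + n)%N -> (3 <= size d + n)%N -> incomp c d -> H (swap c d).
  elim: n c d => [|n IH] c d sc sd i.
    by apply: (u c d) => //; [exact: type_refl | exact: type_refl | lia | lia].
  have ic e : incomp (c ++ [:: e]) (d ++ [:: e]).
    by apply: incomp_catr; rewrite incompC; apply: incomp_catr; rewrite incompC.
  rewrite -swap_split //; case: gH => _ Hc _.
  by apply: Hc; apply: IH; rewrite // size_cat /=; lia.
by apply: (sub3 3); lia.
Qed.

(** An element of [H] conjugates transpositions within a type to elements of [H], which by
    hypothesis again transpose cones of equal type. Applying this to the inverse gives the converse
    implication. *)
Lemma swap_type_eq : (forall a b, swap_type a b <-> R a b) -> H = stabilizerV R.
Proof.
move=> SR; apply/seteqP; split=> // h Hh.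
have pres k a b a' b' : H k -> (3 <= size a)%N -> (3 <= size b)%N ->
    (3 <= size a')%N -> (3 <= size b')%N ->
    address_act k a a' -> address_act k b b' -> R a b -> R a' b'.
  move=> Hk sa sb sa' sb' aa bb ab; have /thompsonVP[kb [N kN]] := HV Hk.
  (* As [a] and [b] may overlap, both are compared with a third address, long enough for its image
     to have length at least 3. *)
  have [|//|c [ca sc s3 ci]] := @fresh_address R scR [:: a; b] (N + 3)%N a.
    by move=> l; rewrite !inE => /orP[] /eqP ->.
  have [|c' cc] := kN c; first lia.
  have sc' : (3 <= size c')%N by exact: act_size_ge sc cc.
  have half d d' : R d c -> incomp c d -> (3 <= size d')%N -> address_act k d d' -> R d' c'.
    move=> dc; rewrite incompC => icd sd' dd.
    apply/SR; apply: swap_typeI => //; first exact: incomp_act dd cc icd.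
    by apply: (group_swap_conj gH Hk kb icd dd cc); exact: swapH.
  apply: (type_trans tsR) (half a a' _ _ _ _) _ => //.
  - exact: type_sym.
  - by apply: ci; rewrite inE eqxx.
  - apply: (type_sym tsR); apply: (half b b') => //.
      by apply: (type_trans tsR) (type_sym tsR ca); exact: type_sym.
    by apply: ci; rewrite !inE eqxx orbT.
apply/stabilizerVP => //; split; first exact: HV.
have /thompsonVP[_ [N hN]] := HV Hh.
have [k Hk [hk kh]] : exists2 k, H k & cancel h k /\ cancel k h by case: gH => _ _; apply.
exists (N + 3)%N => a b a' b' sa sb aa bb.
have sa' := act_size_ge hN sa aa; have sb' := act_size_ge hN sb bb.
split; first by apply: (pres h) => //; lia.
by apply: (pres k) => //; [lia|lia| | ]; exact: address_act_inv hk _.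
Qed.

End Maximality.

Theorem simple_maximal R : simple_type_system R -> strongly_connected R ->
  maximal_subgroup thompsonV (stabilizerV R).
Proof.
move=> [tsR sR] scR; have gG : group_of_maps (stabilizerV R) by exact: stabilizerV_group.
have sub : subgroup thompsonV (stabilizerV R) by split=> // g [].
have nu : ~ universal_relation R by move=> /(sR R tsR)[_ []].
split=> // [E|H [gH HV] RH].
(* If the stabilizer were all of Thompson's group, it would contain [swap c a]. This carries [c] to
   [a] and fixes [d], so with [c] and [d] of one type, [a] would have that type too. *)
- have all3 a b : (3 <= size a)%N -> (3 <= size b)%N -> R a b.
    move=> sa sb; have [|//|c [cb _ sc ci]] := @fresh_address R scR [:: a; b] 0 b.
      by move=> l; rewrite !inE => /orP[] /eqP ->.
    have [|//|d [db _ _ di]] := @fresh_address R scR [:: a; c] 0 b.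
      by move=> l; rewrite !inE => /orP[] /eqP ->.
    have ica : incomp c a by apply: ci; rewrite inE eqxx.
    have ida : incomp d a by apply: di; rewrite inE eqxx.
    have idc : incomp d c by apply: di; rewrite !inE eqxx !orbT.
    have : stabilizerV R (swap c a) by rewrite E; exact: swap_thompsonV.
    move=> /(stabilizerVP R)[_ [N NP]]; apply: (type_ext tsR (n := N)) => s sN.
    have Rbd : R (d ++ s) (b ++ s) by exact: type_cat.
    apply: type_trans Rbd => //; apply/(NP (c ++ s) (d ++ s)); rewrite ?size_cat ?sN ?leq_addl //.
    + exact/address_act_cat/swap_l.
    + by apply/address_act_cat/swap_fix; rewrite incompC.
    + apply: type_cat => //; apply: type_trans cb _ => //; exact: type_sym.
  case: nu => a b; apply: (type_ext tsR (n := 3)) => s s3.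
  by apply: all3; rewrite size_cat s3 leq_addl.
have tsQ := swap_type_type_system tsR scR gH RH.
have [QR|QR] := EM (forall a b, swap_type R H a b <-> R a b).
  by left; exact: swap_type_eq QR.
right; apply: (swap_type_universal tsR gH HV); apply/(sR _ tsQ).
split=> // a b ab a' b' aa bb _ _ i.
apply/RH/swap_stabilizerV => //.
by apply: (type_trans tsR) aa _; apply: (type_trans tsR) ab _; exact: type_sym.
Qed.

(** * Strongly connected type systems *)

Lemma strongly_connected_nuclear R :
  type_system R -> strongly_connected R -> nuclear_type_system R.
Proof.
move=> tsR scR; split=> //; exists 1%N, (types R).
have descE a c : type_descendant R (type_of R a) c = type_of R (a ++ c).
  apply/seteqP; split=> [b [d ad db]|b ab].
    by apply: (type_trans tsR) db; exact: type_cat.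
  by exists a => //; exact: type_refl.
have tyQ a : types R (type_of R a) by exists a.
split; split=> //; first by exists (type_of R [::]).
- by move=> P [a _ <-]; rewrite !descE.
- move=> P P' [a _ <-] [b _ <-].
  (* A letter is read first so that the path is non-empty even when the two types coincide. *)
  have [c cb] := scR (a ++ [:: false]) b; exists (false :: c); split=> //.
    rewrite descE -cat1s catA; apply/seteqP; split=> d.
      by apply: type_trans; rewrite //; exact: type_sym.
    exact: type_trans.
  by move=> z _; rewrite descE.
Qed.

(** * Circular orders and finite invariant sets *)

Section Dynamics.
Variable R : address -> address -> Prop.
Hypotheses (tsR : type_system R) (scR : strongly_connected R).

Lemma stabilizerV_no_circular_order :
  ~ preserves_circular_order_on_dense_set (stabilizerV R).
Proof.
move=> [D [c [dD DG [cycle_succ asym _ tot] inv]]].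
have [x [_ Dx]] : [set: cantor] `&` D !=set0.
  by apply: dD; [exists (fun=> false) | exact: openT].
pose a := xtake 3 x.
have [|//|b [ba _ b3 bi]] := @fresh_address R scR [:: a] 0 a.
  by move=> l; rewrite inE => /eqP ->; rewrite size_xtake.
have [|//|e [ea _ _ ei]] := @fresh_address R scR [:: a; b] 0 a.
  by move=> l; rewrite !inE => /orP[] /eqP ->; rewrite ?size_xtake.
have iba : incomp b a by apply: bi; rewrite inE.
have iea : incomp e a by apply: ei; rewrite inE eqxx.
have ieb : incomp e b by apply: ei; rewrite !inE eqxx orbT.
have Gb : stabilizerV R (swap b a) by exact: swap_stabilizerV.
have Ge : stabilizerV R (swap e a) by exact: swap_stabilizerV.
have Geb : stabilizerV R (swap e b).
  by apply: swap_stabilizerV => //; apply: (type_trans tsR) ea _; exact: type_sym.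
pose w := xdrop 3 x; have xE : x = prepend a w by rewrite /a /w prepend_xtake.
pose y := prepend b w; pose z := prepend e w.
have xy : swap b a x = y by rewrite xE swap_r.
have xz : swap e a x = z by rewrite xE swap_r.
have Dy : D y by rewrite -xy; exact: DG.
have Dz : D z by rewrite -xz; exact: DG.
have ax : in_cone a x := in_cone_xtake 3 x.
have nxy : x <> y.
  by move=> E; move: (incomp_in_cone iba (in_cone_prepend b w)); rewrite -/y -E ax.
have nxz : x <> z.
  by move=> E; move: (incomp_in_cone iea (in_cone_prepend e w)); rewrite -/z -E ax.
have nyz : y <> z.
  by move=> E; move: (incomp_in_cone ieb (in_cone_prepend e w)); rewrite -/z -E in_cone_prepend.
(* Transposing y and z while fixing x reverses the orientation of (x, y, z). *)
have tx : swap e b x = x.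
  apply: swap_out; first by rewrite (incomp_in_cone _ ax) // incompC.
  by rewrite (incomp_in_cone _ ax) // incompC.
have ty : swap e b y = z by rewrite /y swap_r.
have tz : swap e b z = y by rewrite /z swap_l.
have E : c x y z <-> c x z y by rewrite (inv _ x y z Geb) // tx ty tz.
by case: (tot x y z) => // [cx|cx]; apply: (asym x y z) => //; apply/E.
Qed.

(** The orbit of [x] is infinite: transpositions within a type carry [x] into infinitely many
    pairwise disjoint cones. *)
Lemma stabilizerV_no_finite_orbit (F : set cantor) :
  finite_set F -> F !=set0 -> ~ stabilizes_setwise (stabilizerV R) F.
Proof.
move=> /finite_seqP[s sF] [x Fx] FG.
(* Pairwise incomparable addresses in the half not containing [x]; each has an extension that can be
   transposed with the half around [x]. *)
pose pos i : address := ~~ x 0%N :: rcons (nseq i false) true.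
have ipos i j : (i < j)%N -> incomp (pos i) (pos j).
  move=> ij; have -> : pos j = (~~ x 0%N :: nseq i false) ++
      (false :: rcons (nseq (j - i.+1) false) true).
    rewrite /pos -!cats1 /= -{1}(subnKC ij) addSnnS nseqD -catA.
    by case: (j - _)%N.
  by rewrite /pos -cats1 -cat_cons incomp_cat2.
have [f fP] : {f : nat -> address & forall i, R (pos i ++ f i) (xtake 1 x)}.
  by apply: (@choice _ _ (fun i c => R (pos i ++ c) (xtake 1 x))) => i; exact: scR.
have ia i : incomp (pos i ++ f i) (xtake 1 x).
  by rewrite /pos /= /incomp /=; case: (x 0%N).
pose y i := swap (pos i ++ f i) (xtake 1 x) x.
have yin i : in_cone (pos i) (y i).
  rewrite /y -{2}(prepend_xtake 1 x) swap_r //.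
  by apply: in_cone_prefix (prefix_prefix _ _) (in_cone_prepend _ _).
have ys i : y i \in s.
  have : F (y i).
    rewrite -(FG _ (swap_stabilizerV tsR (fP i) (ia i))); by exists x.
  by rewrite sF.
have yinj : injective y.
  suff lt i j : (i < j)%N -> y i <> y j.
    move=> i j E; case: (ltngtP i j) => // [/lt|/lt] [] //.
  by move=> /ipos ij E; have := incomp_in_cone ij (yin i); rewrite E yin.
have : (size (map y (iota 0 (size s).+1)) <= size s)%N.
  apply: uniq_leq_size; first by rewrite map_inj_uniq ?iota_uniq.
  by move=> z /mapP[i _ ->].
by rewrite size_map size_iota ltnn.
Qed.

End Dynamics.

(** * An algebraic form of disjointness of supports *)

Definition algebraically_disjoint (T : Type) (G : set (T -> T)) (f g : T -> T) : Prop :=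
  forall h, G h -> f \o h <> h \o f ->
  exists f1 f2 u k, [/\ G f1, G f2, G u & G k] /\
    [/\ f1 \o g = g \o f1, f2 \o g = g \o f2,
        (* u = [f2, h] and k = [f1, u] *)
        u \o (h \o f2) = f2 \o h, k \o (u \o f1) = f1 \o u &
        k <> id /\ k \o g = g \o k].

(** A purely algebraic substitute for a fixed-point-free [g] whose [p]-th power is trivial: if [g]
    fixed a cone pointwise, transpositions inside that cone would be algebraically disjoint from
    [g]. *)
Definition has_free_torsion (T : Type) (G : set (T -> T)) (p : nat) : Prop :=
  exists g, [/\ G g, iter p (comp g) id = id &
    forall f, G f -> f <> id -> ~ algebraically_disjoint G f g].

Lemma iter_comp (T : Type) (g : T -> T) n x : iter n (comp g) id x = iter n g x.
Proof. by elim: n => //= n ->. Qed.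

Lemma group_iter (T : Type) (G : set (T -> T)) g n :
  group_of_maps G -> G g -> G (iter n (comp g) id).
Proof. by move=> [Gid Gc _] Gg; elim: n => //= n IH; exact: Gc. Qed.

(** The commutator equations were stated without inverses, so they transfer along a bijection that
    respects composition. *)
Lemma has_free_torsion_isomorphic (T : Type) (G H : set (T -> T)) p :
  group_of_maps G -> group_of_maps H -> isomorphic G H ->
  has_free_torsion G p -> has_free_torsion H p.
Proof.
move=> gG gH [phi [[phiH phi_inj phi_surj] phiM]] [g [Gg gp gfree]].
have [[Gid Gc Gi] [Hid _ Hi]] := (gG, gH).
have inj f h : G f -> G h -> phi f = phi h -> f = h.
  by move=> Gf Gh; apply: phi_inj; exact/mem_set.
(* An invertible idempotent is the identity. *)
have phi1 : phi id = id.
  have [h Hh [hK _]] := Hi _ (phiH _ Gid).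
  have E : phi id \o phi id = phi id by rewrite -(phiM id id).
  apply/funext => x; have := congr1 (fun f => h (f x)) E.
  by rewrite /= !hK.
have phiX n : phi (iter n (comp g) id) = iter n (comp (phi g)) id.
  by elim: n => //= n IH; rewrite (phiM g) ?IH //; exact: group_iter.
exists (phi g); split; [exact: phiH | by rewrite -phiX gp |].
move=> _ /phi_surj[f Gf <-] fid dj; apply: (gfree f Gf).
  by move=> E; apply: fid; rewrite E.
move=> h Gh fh; have [|f1 [f2 [u [k [[]]]]]] := dj (phi h) (phiH _ Gh).
  by rewrite -(phiM f h) // -(phiM h f) // => /(inj _ _ (Gc _ _ Gf Gh) (Gc _ _ Gh Gf)).
move=> /phi_surj[{}f1 G1 <-] /phi_surj[{}f2 G2 <-] /phi_surj[{}u Gu <-] /phi_surj[{}k Gk <-].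
move=> [E1 E2 E3 E4 [kid E5]]; exists f1, f2, u, k; split; first by split.
split; last split.
- by apply: inj; [exact: Gc | exact: Gc | rewrite (phiM f1 g) // (phiM g f1)].
- by apply: inj; [exact: Gc | exact: Gc | rewrite (phiM f2 g) // (phiM g f2)].
- have Ghf : G (h \o f2) by exact: Gc.
  by apply: inj; [exact: Gc | exact: Gc | rewrite (phiM u (h \o f2)) // (phiM h f2) // (phiM f2 h)].
- have Guf : G (u \o f1) by exact: Gc.
  by apply: inj; [exact: Gc | exact: Gc | rewrite (phiM k (u \o f1)) // (phiM u f1) // (phiM f1 u)].
- by move=> E; apply: kid; rewrite E.
- by apply: inj; [exact: Gc | exact: Gc | rewrite (phiM k g) // (phiM g k)].
Qed.

Lemma disjoint_commute (T : Type) (f g : T -> T) : injective f -> injective g ->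
  (forall x, f x = x \/ g x = x) -> f \o g = g \o f.
Proof.
move=> fi gi fg; apply/funext => x /=.
have [fx|gx] := fg x.
  rewrite fx; have [//|ggx] := fg (g x).
  by have := gi _ _ ggx => ->.
rewrite gx; have [ffx|//] := fg (f x).
by have := fi _ _ ffx => ->.
Qed.

Definition supported (f : cantor -> cantor) (a : address) : Prop :=
  forall x, ~~ in_cone a x -> f x = x.

Lemma swap_supported a b c : prefix a b -> prefix a c -> supported (swap b c) a.
Proof.
move=> ab ac x ax; rewrite swap_out //; apply: contra ax; exact: in_cone_prefix.
Qed.

Definition displaces (h : cantor -> cantor) (a : address) : Prop :=
  forall y, in_cone a y -> ~~ in_cone a (h y).

Lemma displaces_prefix h a b : prefix a b -> displaces h a -> displaces h b.
Proof.
move=> ab ha y /(in_cone_prefix ab)/ha; apply: contra; exact: in_cone_prefix.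
Qed.

Lemma prefix_xtake m n x : (m <= n)%N -> prefix (xtake m x) (xtake n x).
Proof. by move=> mn; rewrite prefixE size_xtake take_xtake. Qed.

Lemma thompsonV_displaces h x : thompsonV h -> h x <> x ->
  exists n, displaces h (xtake n x).
Proof.
move=> /thompsonVP[hb [N hN]] hx.
have [k xk] : exists k, h x k <> x k.
  by apply: contrapT => /forallNP nk; apply: hx; apply/funext => k; exact: contrapT.
(* At this depth the image of the cone determines at least [k.+1] letters. So [h y] agrees with
   [h x] at [k], where [h x] differs from [x]. *)
exists (N + k.+1)%N => y xy; apply/negP => xhy.
have [|b bb] := hN (xtake (N + k.+1) x); first by rewrite size_xtake leq_addr.
have kb : (k.+1 <= size b)%N by apply: (act_size_ge hN _ bb); rewrite size_xtake.
have ib z : in_cone (xtake (N + k.+1) x) z -> xtake (size b) (h z) = b.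
  by rewrite -(in_cone_act _ (bij_inj hb) bb) => /eqP.
have /xtake_eqP E : xtake (size b) (h x) = xtake (size b) (h y).
  by rewrite !ib ?in_cone_xtake.
move: xhy; rewrite /in_cone size_xtake => /eqP /xtake_eqP E'.
by apply: xk; rewrite E // E' // -ltnS; lia.
Qed.

Section Disjointness.
Variable R : address -> address -> Prop.
Hypotheses (tsR : type_system R) (scR : strongly_connected R).
Local Notation G := (stabilizerV R).

Let GV g : G g -> thompsonV g. Proof. by case. Qed.
Let Gbij g : G g -> bijective g. Proof. by move=> /GV/thompsonV_bij. Qed.
Let Ginj g : G g -> injective g. Proof. by move=> /Gbij/bij_inj. Qed.

(** From each of three disjoint cones inside that of [a], strong connectedness leads back to the
    type of [a]. *)
Lemma three_addresses a : exists b c d,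
  [/\ prefix a b, prefix a c & prefix a d] /\
  [/\ incomp b c, incomp c d, incomp b d, R b c & R c d].
Proof.
have [b bP] := scR (a ++ [:: false; false]) a.
have [c cP] := scR (a ++ [:: false; true]) a.
have [d dP] := scR (a ++ [:: true]) a.
exists ((a ++ [:: false; false]) ++ b), ((a ++ [:: false; true]) ++ c),
  ((a ++ [:: true]) ++ d); rewrite -!catA in bP cP dP *; split.
  by split; exact: prefix_prefix.
split; rewrite ?incomp_cat2 //; by [apply: (type_trans tsR) bP _; exact: type_sym
  | apply: (type_trans tsR) cP _; exact: type_sym].
Qed.

Lemma swap_neq_id b c : incomp b c -> swap b c <> id.
Proof.
move=> bc E; have := incomp_in_cone bc (in_cone_prepend b (fun=> false)).
by rewrite -[prepend b _]/(id _) -E swap_l in_cone_prepend.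
Qed.

(* Take h supported in a small cone U around x.  Then k = [f1, [f2, h]] is supported in the
   four sets U, f1 U, f2 U and f1 f2 U and commutes with g, so two of the five points
   y, g y, ..., g^4 y of its support lie in the same set; as f1 and f2 commute with g,
   some g^d U meets U. *)
Lemma algebraically_disjoint_short_orbit f g x : G f -> G g ->
  algebraically_disjoint G f g -> f x <> x -> ~ forall d, (0 < d < 5)%N -> iter d g x <> x.
Proof.
move=> Gf Gg dj fx gx; have gG := stabilizerV_group R.
have [n [nf ng]] : exists n, displaces f (xtake n x) /\
    forall d, (0 < d < 5)%N -> displaces (iter d g) (xtake n x).
  have [n0 n0P] := thompsonV_displaces (GV Gf) fx.
  have [m mP] : {m : nat -> nat & forall d, (0 < d < 5)%N -> displaces (iter d g) (xtake (m d) x)}.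
    apply: (@choice _ _ (fun d m => (0 < d < 5)%N -> displaces (iter d g) (xtake m x))) => d.
    case: (boolP (0 < d < 5)%N) => [d5|]; last by exists 0%N.
    have Gd := group_iter d gG Gg; have [|m mP] := thompsonV_displaces (GV Gd) (x := x).
      by rewrite iter_comp; exact: gx.
    by exists m => _ y; rewrite -iter_comp; exact: mP.
  exists (n0 + (m 1 + m 2 + m 3 + m 4))%N; split.
    by apply: displaces_prefix n0P; apply: prefix_xtake; lia.
  move=> d d5; apply: displaces_prefix (mP d d5); apply: prefix_xtake.
  by move: d5; case: d => [|[|[|[|[|d]]]]] // _; lia.
set U := xtake n x in nf ng.
have [b [c [_ [[ab ac _] [bc _ _ Rbc _]]]]] := three_addresses U.
pose h := swap b c; have Gh : G h by exact: swap_stabilizerV.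
have hU : supported h U by exact: swap_supported.
have hi := Ginj Gh; have fi := Ginj Gf.
have fh : f \o h <> h \o f.
  move=> E; pose y := prepend b (fun=> false).
  have Uy : in_cone U y by apply: in_cone_prefix (in_cone_prepend _ _).
  have := congr1 (@^~ y) E => /=; rewrite (hU (f y)) ?nf // => /fi.
  rewrite /h /y swap_l => E'; have := incomp_in_cone bc (in_cone_prepend b (fun=> false)).
  by rewrite -E' in_cone_prepend.
have [f1 [f2 [u [k [[G1 G2 Gu Gk] [c1 c2 uE kE [kid kg]]]]]]] := dj h Gh fh.
have [[h1 h1K K1h] [h2 h2K K2h]] := (Gbij G1, Gbij G2).
(* The commutator [u] moves only points of [U] and of its translate by [f2]. *)
have ufix y : ~~ in_cone U y -> ~~ in_cone U (h2 y) -> u y = y.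
  move=> Uy Uy2; have := congr1 (@^~ (h2 y)) uE.
  by rewrite /= (hU (h2 y)) // K2h (hU y).
have kfix y : ~~ in_cone U y -> ~~ in_cone U (h2 y) ->
    ~~ in_cone U (h1 y) -> ~~ in_cone U (h2 (h1 y)) -> k y = y.
  move=> U0 U2 U1 U12; have := congr1 (@^~ (h1 y)) kE.
  by rewrite /= (ufix (h1 y)) // K1h (ufix y).
have c12 : (f1 \o f2) \o g = g \o (f1 \o f2).
  by rewrite -compA c2 compA c1.
pose e (t : 'I_4) := nth id [:: id; f1; f2; f1 \o f2] t.
have eP t : e t \o g = g \o e t /\ injective (e t).
  case: t => -[|[|[|[|//]]]] /= i; rewrite /e /=; split=> //.
  - exact: Ginj.
  - exact: Ginj.
  - by apply: inj_comp; exact: Ginj.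
have cov y : k y <> y -> exists t, exists2 z, in_cone U z & y = e t z.
  move=> ky; apply: contrapT => nt.
  have nn i z : y = nth id [:: id; f1; f2; f1 \o f2] i z -> (i < 4)%N -> ~~ in_cone U z.
    by move=> yE i4; apply/negP => Uz; apply: nt; exists (Ordinal i4); exists z.
  apply: ky; apply: kfix.
  - exact: (nn 0%N).
  - by apply: (nn 2%N) => //=; rewrite K2h.
  - by apply: (nn 1%N) => //=; rewrite K1h.
  - by apply: (nn 3%N) => //=; rewrite K2h K1h.
have [y ky] : exists y, k y <> y.
  by apply: contrapT => /forallNP nk; apply: kid; apply/funext => y; exact: contrapT.
have kgy j : k (iter j g y) <> iter j g y.
  elim: j => //= j IH; have := congr1 (@^~ (iter j g y)) kg => /= ->.
  by move=> /(Ginj Gg).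
have [t tP] : {t : 'I_5 -> 'I_4 & forall j : 'I_5, exists2 z, in_cone U z & iter j g y = e (t j) z}.
  apply: (@choice _ _ (fun (j : 'I_5) t => exists2 z, in_cone U z & iter j g y = e t z)) => j.
  exact/cov/kgy.
have eg s d z : iter d g (e s z) = e s (iter d g z).
  elim: d => //= d ->; exact: (esym (congr1 (@^~ (iter d g z)) (eP s).1)).
have clash (i j : 'I_5) : (i < j)%N -> t i = t j -> False.
  move=> ij tij; have [z1 U1 E1] := tP i; have [z2 U2 E2] := tP j.
  move: E2; rewrite -tij -(subnK (ltnW ij)) iterD E1 eg => /(eP _).2 E2.
  have : (0 < j - i < 5)%N by have := ltn_ord j; lia.
  by move=> /ng /(_ _ U1); rewrite E2 U2.
have : injective t.
  move=> i j tij; case: (ltngtP i j) => [ij|ji|/val_inj //].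
    by case: (clash i j).
  by case: (clash j i).
by move=> /leq_card; rewrite !card_ord.
Qed.

(** If [h] does not commute with [f], it moves some cone [d] inside that of [a] off itself. For
    [f1], [f2] supported in [d], the conjugate of [f2] by [h] is supported off [d] and commutes with
    [f1], so [[f1, [f2, h]]] reduces to [[f1, f2]]. Here this is the square of a 3-cycle of cones,
    and it commutes with [g] since [g] is trivial on [d]. *)
Lemma supported_algebraically_disjoint f g a : G f -> G g -> supported f a ->
  (forall y, in_cone a y -> g y = y) -> algebraically_disjoint G f g.
Proof.
move=> Gf Gg fa ga h Gh fh; have [Gid Gc Gi] := stabilizerV_group R.
have [y ay hy] : exists2 y, in_cone a y & h y <> y.
  apply: contrapT => nh; have ha z : in_cone a z -> h z = z.
    by move=> az; apply: contrapT => hz; apply: nh; exists z.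
  apply: fh; apply: disjoint_commute; [exact: Ginj | exact: Ginj | move=> z].
  by case: (boolP (in_cone a z)) => [/ha|/fa]; [right | left].
have [n hn] := thompsonV_displaces (GV Gh) hy.
pose d := xtake (maxn n (size a)) y.
have hd : displaces h d.
  by apply: displaces_prefix hn; apply: prefix_xtake; rewrite leq_maxl.
have ad : prefix a d.
  by move: ay; rewrite /in_cone => /eqP <-; apply: prefix_xtake; rewrite leq_maxr.
have [b [c [e [[db dc de] [bc ce be Rbc Rce]]]]] := three_addresses d.
pose f1 := swap b c; pose f2 := swap c e.
have G1 : G f1 by exact: swap_stabilizerV.
have G2 : G f2 by exact: swap_stabilizerV.
have [h' Gh' [hK Kh]] := Gi _ Gh.
have commg k : G k -> supported k d -> k \o g = g \o k.
  move=> Gk kd; apply: disjoint_commute; [exact: Ginj | exact: Ginj | move=> z].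
  case: (boolP (in_cone d z)) => [dz|/kd]; last by left.
  by right; apply: ga; exact: in_cone_prefix dz.
have s1 : supported f1 d by exact: swap_supported.
have s2 : supported f2 d by exact: swap_supported.
have k1 : f1 \o f1 = id by apply/funext => z; exact: swapK.
have k2 : f2 \o f2 = id by apply/funext => z; exact: swapK.
pose v := h \o f2 \o h'; have Gv : G v by apply: (Gc) => //; exact: Gc.
have vf1 : v \o f1 = f1 \o v.
  apply: disjoint_commute; [exact: Ginj | exact: Ginj | move=> z].
  case: (boolP (in_cone d z)) => [dz|/s1]; last by right.
  left; rewrite /v /= s2 ?Kh //; apply/negP => /hd.
  by rewrite Kh dz.
exists f1, f2, (f2 \o v), ((f1 \o f2) \o (f1 \o f2)).
have G12 : G (f1 \o f2) by exact: Gc.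
have GK : G ((f1 \o f2) \o (f1 \o f2)) by exact: Gc.
split; first by split=> //; exact: Gc.
split; [exact: commg | exact: commg | | | split].
- apply/funext => z; rewrite /v /= hK; congr f2; congr h.
  exact: (congr1 (@^~ z) k2).
- have k1z z : f1 (f1 z) = z by exact: (congr1 (@^~ z) k1).
  have k2z z : f2 (f2 z) = z by exact: (congr1 (@^~ z) k2).
  apply/funext => z /=; have vz := congr1 (@^~ z) vf1; rewrite /= in vz.
  by rewrite vz k2z k1z.
- move=> E; have := congr1 (@^~ (prepend b (fun=> false))) E => /=.
  rewrite [f2 (prepend b _)]swap_out; last 2 first.
  + by rewrite (incomp_in_cone bc) // in_cone_prepend.
  + by rewrite (incomp_in_cone be) // in_cone_prepend.
  rewrite [f1 (prepend b _)]swap_l [f2 _]swap_l [f1 _]swap_out; last 2 first.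
  + by rewrite (incomp_in_cone _ (in_cone_prepend e _)) // incompC.
  + by rewrite (incomp_in_cone _ (in_cone_prepend e _)) // incompC.
  move=> E'; have := incomp_in_cone be (in_cone_prepend b (fun=> false)).
  by rewrite -E' in_cone_prepend.
- apply: commg => // z dz; rewrite /=.
  by rewrite (s2 z) // (s1 z) // (s2 z) // (s1 z).
Qed.

End Disjointness.

(** * The automaton of types *)

(** The index of [Pos] is shifted by one: [Pos k i] stands for index [i.+1], so that weight 0 has
    the single name [Zero] at all levels. *)
Inductive state := Zero | Neg | Pos of nat & nat.

HB.instance Definition _ := gen_eqMixin state.

(* [pos k j] weighs j / (m 0 * ... * m k), with [pos k 0 = Zero]; [Zero] and [Neg] weigh
   0 and -1.  The root [pos 0 (m 0)] weighs 1 and the weight of a state is the sum of the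
   weights of its two children. *)
Definition pos (k j : nat) : state := if j is i.+1 then Pos k i else Zero.

Definition step (m : nat -> nat) (q : state) (c : bool) : state :=
  match q with
  | Zero => if c then Neg else pos 0 (m 0)
  | Neg => if c then Zero else Neg
  | Pos k j => if c then pos k.+1 (m k.+1) else pos k j
  end.

Definition state_of (m : nat -> nat) (a : address) : state :=
  foldl (step m) (pos 0 (m 0)) a.

Definition same_state (m : nat -> nat) (a b : address) : Prop :=
  state_of m a = state_of m b.

Section Automaton.
Variable m : nat -> nat.
Hypothesis m_gt0 : forall k, (0 < m k)%N.
Local Notation st := (state_of m).
Local Notation R := (same_state m).

Lemma state_of_cat a b : st (a ++ b) = foldl (step m) (st a) b.
Proof. by rewrite /state_of foldl_cat. Qed.

Lemma state_of_rcons a c : st (rcons a c) = step m (st a) c.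
Proof. by rewrite /state_of foldl_rcons. Qed.

Lemma pos_inj k j i : pos k j = pos k i -> j = i.
Proof. by case: j i => [|j] [|i] //= [->]. Qed.

Lemma posE k j : (0 < j)%N -> pos k j = Pos k j.-1.
Proof. by case: j. Qed.

(** Right children tell [Zero], [Neg] and positive states apart and fix the level of the latter; the
    left child then fixes the index. *)
Lemma step_inj q r : step m q false = step m r false ->
  step m q true = step m r true -> q = r.
Proof.
case: q r => [||k j] [||l i] //=; rewrite ?(posE _ (m_gt0 _)) //.
by move=> E [kl _]; subst l; rewrite -(pos_inj E).
Qed.

Lemma same_state_type_system : type_system R.
Proof.
split; first by split=> [a|a b|a b c] //; rewrite /same_state => -> .
move=> a b; rewrite /same_state !state_of_rcons; split=> [->//|[f t]].
exact: step_inj.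
Qed.

Lemma foldl_pos k j : foldl (step m) (pos k j) (nseq j false) = Zero.
Proof. by elim: j. Qed.

(** Every state leads to [Zero], and the left child of [Zero] is the root, from which reading [b]
    gives the state of [b]. *)
Lemma same_state_strongly_connected : strongly_connected R.
Proof.
move=> a b; have [c cZ] : exists c, foldl (step m) (st a) c = Zero.
  case: (st a) => [||k j]; [by exists [::] | by exists [:: true] |].
  by exists (nseq j.+1 false); rewrite -[RHS](foldl_pos k j.+1).
by exists (c ++ false :: b); rewrite /same_state state_of_cat foldl_cat cZ.
Qed.

Lemma exists_Neg : exists a, st a = Neg.
Proof. by exists (rcons (nseq (m 0) false) true); rewrite state_of_rcons /state_of foldl_pos. Qed.

Lemma exists_Zero : exists a, st a = Zero.
Proof. by exists (nseq (m 0) false); rewrite /state_of foldl_pos. Qed.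

(* [Neg] is the only state that is its own left child, so a symmetry of the automaton
   fixes it, and hence, by strong connectedness, every state. *)
Lemma stabilizerV_preserves_state g : stabilizerV R g ->
  exists N, forall a a', (N <= size a)%N -> address_act g a a' -> st a = st a'.
Proof.
move=> /(stabilizerVP R)[/thompsonVP[gb [K gK]] [N NP]].
have [n nN] := exists_Neg.
have [c cN] := same_state_strongly_connected (nseq (K + N) false) n.
pose a := nseq (K + N) false ++ c.
have sa : (K + N <= size a)%N by rewrite size_cat size_nseq leq_addr.
have [|a' aa] := gK a; first by apply: leq_trans sa; rewrite leq_addr.
have saN : (N <= size a)%N by apply: leq_trans sa; rewrite leq_addl.
have aN : st a = Neg by rewrite -nN.
have a'N : st a' = Neg.
  have : R a' (a' ++ [:: false]).
    apply/(NP a (a ++ [:: false])) => //; first by rewrite size_cat (leq_trans saN) ?leq_addr.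
      exact: address_act_cat.
    by rewrite /same_state state_of_cat /= aN.
  rewrite /same_state state_of_cat /=; case: (st a') => [||k [|j]] //=.
    by rewrite posE.
  by move=> [] /eqP; rewrite eqn_leq ltnn.
exists N => b b' sb bb; have [d db] := same_state_strongly_connected a b.
have : R (a' ++ d) b'.
  apply/(NP (a ++ d) b) => //; first by rewrite size_cat (leq_trans saN) ?leq_addr.
  exact: address_act_cat.
by rewrite -db /same_state (state_of_cat a) (state_of_cat a') aN a'N => <-.
Qed.

Hypothesis m_inj : injective m.

(** * Quotients of the type system of the automaton *)

Section Quotient.
Variable Q : address -> address -> Prop.
Hypotheses (tsQ : type_system Q) (RQ : forall a b, R a b -> Q a b).

Let quot (p q : state) : Prop := exists a b, [/\ st a = p, st b = q & Q a b].

Let quot_sym p q : quot p q -> quot q p.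
Proof. by move=> [a [b [ap bq ab]]]; exists b, a; split=> //; exact: type_sym. Qed.

Let quot_step c p q : quot p q -> quot (step m p c) (step m q c).
Proof.
move=> [a [b [ap bq ab]]]; exists (a ++ [:: c]), (b ++ [:: c]).
by rewrite !state_of_cat ap bq; split=> //; exact: type_cat.
Qed.

Let quotE a b : quot (st a) (st b) -> Q a b.
Proof.
move=> [c [d [ca db cd]]]; apply: (type_trans tsQ) (RQ (esym ca)) _.
by apply: (type_trans tsQ) cd _; exact: RQ.
Qed.

(** The right child of [Zero] is [Neg]. Comparing left children identifies the root with [Neg],
    hence with [Zero]. So both children of [Zero] are identified with it, and every state occurs
    below [Zero]. *)
Let Zero_Neg : quot Zero Neg -> universal_relation Q.
Proof.
move=> zn; have [z zZ] := exists_Zero.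
have child c : Q (z ++ [:: c]) z.
  case: c; apply: quotE; rewrite state_of_cat zZ /=; first exact: quot_sym.
  have [n nN] := exists_Neg; have := quot_step false zn => /=.
  move=> [a [b [aE bE ab]]]; exists a, z; split=> //; apply: (type_trans tsQ) ab _.
  by apply: quotE; rewrite bE zZ; exact: quot_sym.
have all c : Q (z ++ c) z.
  elim/last_ind: c => [|c e IH]; first by rewrite cats0; exact: type_refl.
  rewrite -cats1 catA; apply: (type_trans tsQ) (child e).
  exact: type_cat.
have allz a : Q a z.
  have [c ca] := same_state_strongly_connected z a.
  by apply: (type_trans tsQ) (all c); apply: RQ; exact: (esym ca).
by move=> a b; apply: (type_trans tsQ) (allz a) _; apply: (type_sym tsQ); exact: allz.
Qed.

(** Left children lower [pos k j] to [Zero] and leave [Neg] unchanged. *)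
Let pos_Neg k j : quot (pos k j) Neg -> quot Zero Neg.
Proof. by elim: j => //= j IH /(quot_step false). Qed.

Let Pos_Zero k j : quot (Pos k j) Zero -> quot Zero Neg.
Proof. by move=> /(quot_step true); exact: pos_Neg. Qed.

(** Left children lower both indices until the smaller one reaches [Zero]. *)
Let pos_pos k j l i : j <> i -> quot (pos k j) (pos l i) -> quot Zero Neg.
Proof.
elim: j i => [|j IH] [|i] // ji.
- by move=> /quot_sym; exact: Pos_Zero.
- exact: Pos_Zero.
- by move=> /(quot_step false); apply: IH => E; apply: ji; rewrite E.
Qed.

Lemma proper_quotient_universal a b : Q a b -> ~ R a b -> universal_relation Q.
Proof.
move=> ab nab; have : quot (st a) (st b) by exists a, b.
have : st a <> st b by [].
move=> + q; move: q; case: (st a) (st b) => [||k j] [||l i] // q pq; apply: Zero_Neg => //.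
- by apply: Pos_Zero (quot_sym q).
- exact: quot_sym.
- by apply: (pos_Neg (k := l) (j := i.+1)); exact: quot_sym.
- exact: Pos_Zero q.
- exact: (pos_Neg (k := k) (j := j.+1)).
- have [ji|ji] := eqVneq j i; last first.
    by apply: (pos_pos (k := k) (j := j.+1) (l := l) (i := i.+1)) => // -[]; apply/eqP.
  (* Equal indices at different levels: the right children have indices [m k.+1] and [m l.+1], which
     differ since [m] is injective. *)
  apply: (pos_pos _ (quot_step true q)) => /m_inj[kl].
  by apply: pq; rewrite ji kl.
Qed.

End Quotient.

Lemma same_state_simple : simple_type_system R.
Proof.
split; first exact: same_state_type_system.
move=> Q tsQ; split=> [[RQ nQ]|u].
  have [a [b [ab nab]]] : exists a b, Q a b /\ ~ R a b.
    apply: contrapT => nab; apply: nQ => a b; split; last exact: RQ.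
    by move=> ab; apply: contrapT => nRab; apply: nab; exists a, b.
  exact: proper_quotient_universal ab nab.
split=> // E; have [n nN] := exists_Neg; have [z zZ] := exists_Zero.
by have := u n z; rewrite E /same_state nN zZ.
Qed.

End Automaton.

(** * Torsion elements without fixed points *)

(* Successor in the partition of a list into consecutive cycles of length p. *)
Definition cycle_succ (T : eqType) (p : nat) (s : seq T) (x : T) : T :=
  nth x s (index x s %/ p * p + (index x s %% p).+1 %% p).

Section Cycles.
Variables (T : eqType) (p : nat) (s : seq T).
Hypotheses (p_gt0 : (0 < p)%N) (s_uniq : uniq s) (ps : (p %| size s)%N).

(** As [p] divides the length, a block of [p] positions containing a valid index lies wholly inside
    the list. *)
Lemma cycle_succ_ltn i r : (i < size s)%N -> (i %/ p * p + r %% p < size s)%N.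
Proof.
move=> iS; case/dvdnP: ps => c sc; rewrite sc in iS *.
have ic : (i %/ p < c)%N by rewrite ltn_divLR.
apply: (@leq_trans (i %/ p * p + p)); first by rewrite ltn_add2l ltn_mod.
by rewrite -mulSnr leq_mul2r ic orbT.
Qed.

Lemma cycle_succ_mem x : x \in s -> cycle_succ p s x \in s.
Proof. by move=> xs; rewrite mem_nth // cycle_succ_ltn // index_mem. Qed.

Lemma iter_cycle_succ x r : x \in s ->
  iter r (cycle_succ p s) x = nth x s (index x s %/ p * p + (index x s %% p + r) %% p).
Proof.
move=> xs; have ix : (index x s < size s)%N by rewrite index_mem.
elim: r => [|r IH] /=; first by rewrite addn0 modn_mod -divn_eq nth_index.
rewrite IH /cycle_succ; set j := (_ + _ %% p)%N.
have js : (j < size s)%N by exact: cycle_succ_ltn.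
rewrite index_uniq // (set_nth_default x); last exact: cycle_succ_ltn.
have -> : (j %/ p = index x s %/ p)%N.
  by rewrite /j divnMDl // (@divn_small (_ %% p)) ?ltn_mod ?addn0.
have -> : (j %% p = (index x s %% p + r) %% p)%N by rewrite /j modnMDl modn_mod.
by rewrite -addn1 modnDml -addnA addn1.
Qed.

Lemma iter_cycle_succ_id x : x \in s -> iter p (cycle_succ p s) x = x.
Proof.
by move=> xs; rewrite iter_cycle_succ // modnDr modn_mod -divn_eq nth_index.
Qed.

Lemma cycle_succ_neq x : (1 < p)%N -> x \in s -> cycle_succ p s x <> x.
Proof.
move=> p1 xs; have ix : (index x s < size s)%N by rewrite index_mem.
rewrite -[LHS]/(iter 1 (cycle_succ p s) x) iter_cycle_succ // => /(congr1 (index^~ s)).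
rewrite index_uniq // ?cycle_succ_ltn // => /(congr1 (modn^~ p)).
rewrite modnMDl modn_mod; have := ltn_pmod (index x s) p_gt0.
set k := (index x s %% p)%N => kp; have [k1|k1] := ltnP (k + 1) p.
  by rewrite modn_small //; lia.
by have -> : (k + 1 = p)%N by [lia]; rewrite modnn; lia.
Qed.

End Cycles.

Section FreeTorsion.
Variable R : address -> address -> Prop.
Hypothesis tsR : type_system R.
Variables (S : eqType) (st : address -> S).
Hypothesis stR : forall a b, st a = st b -> R a b.

(** The members of each state are permuted in cycles of length [p]. Every member is sent to a
    different one, so no point is fixed. *)
Lemma code_free_torsion L p : is_code L -> (1 < p)%N ->
  (forall q, (p %| count (fun a => st a == q) L)%N) ->
  exists g, [/\ stabilizerV R g, forall x, iter p g x = x & forall x, g x <> x].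
Proof.
move=> cL p1 pL; have p0 : (0 < p)%N by lia.
pose block a := [seq b <- L | st b == st a].
have bu a : uniq (block a) by rewrite filter_uniq // code_uniq.
have bp a : (p %| size (block a))%N by rewrite size_filter.
have ba a : a \in L -> a \in block a by rewrite mem_filter eqxx.
pose f a := cycle_succ p (block a) a.
have fL a : a \in L -> f a \in L /\ st (f a) = st a.
  move=> aL; have := cycle_succ_mem p0 (bp a) (ba a aL).
  by rewrite mem_filter => /andP[/eqP].
have iterf a r : a \in L -> [/\ iter r f a = iter r (cycle_succ p (block a)) a,
    iter r f a \in L & st (iter r f a) = st a].
  move=> aL; elim: r => //= r [E rL sr]; have [frL sfr] := fL _ rL.
  by split=> //; [rewrite {1}/f E /block -E sr | rewrite sfr].
have fp a : a \in L -> iter p f a = a.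
  by move=> aL; have [-> _ _] := iterf a p aL; rewrite iter_cycle_succ_id // ba.
have ff a : a \in L -> f a <> a by move=> aL; apply: cycle_succ_neq; rewrite // ba.
(* The member of the code whose cone contains [x]; the default is never reached, since a code covers
   every point. *)
pose hd x := nth [::] L (find (in_cone^~ x) L).
pose g x := prepend (f (hd x)) (xdrop (size (hd x)) x).
have gf a : a \in L -> address_act g a (f a).
  move=> aL w; have ha : has (in_cone^~ (prepend a w)) L.
    by apply/hasP; exists a => //; exact: in_cone_prepend.
  have hdE : hd (prepend a w) = a.
    apply: (code_uniq_in_cone cL _ aL) (nth_find _ ha) (in_cone_prepend a w).
    by rewrite mem_nth // -has_find.
  by rewrite /g hdE xdrop_prepend.
have gr r a : a \in L -> address_act (iter r g) a (iter r f a).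
  move=> aL; elim: r => [//|r IH] w; have [_ rL _] := iterf a r aL.
  by rewrite iterS IH gf.
have gp x : iter p g x = x.
  by have [a aL /in_coneP[w ->]] := code_cover x cL; rewrite gr // fp.
have gb : bijective g.
  exists (iter p.-1 g) => x; first by rewrite -iterSr prednK.
  by rewrite -iterS prednK.
pose N := \max_(a <- L) size a.
have gN c : (N <= size c)%N -> exists2 c', address_act g c c' & R c c'.
  move=> sc; have [a aL ac] := code_cover (prepend c (fun=> false)) cL.
  have sa : (size a <= size c)%N by apply: leq_trans sc; exact: leq_bigmax_seq.
  have /prefixP[d ->] := in_cone_prepend_prefix sa ac.
  exists (f a ++ d); first exact/address_act_cat/gf.
  by apply: type_cat => //; apply: stR; have [_ ->] := fL a aL.
exists g; split=> //.
- apply: type_preserving_stabilizerV => //.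
    by apply/thompsonVP; split=> //; exists N => c /gN[c' cc' _]; exists c'.
  exists N => c c' sc cc'; have [d cd Rcd] := gN c sc.
  by rewrite (address_act_uniq cc' cd).
- move=> x gx; have [a aL /in_coneP[w xE]] := code_cover x cL.
  have [faL _] := fL a aL; apply: (ff a aL).
  apply: (@code_uniq_in_cone L _ _ x cL faL aL); last by rewrite xE in_cone_prepend.
  by rewrite -gx xE gf // in_cone_prepend.
Qed.

End FreeTorsion.

Lemma iter_fixed (T : Type) (g : T -> T) n x : g x = x -> iter n g x = x.
Proof. by move=> gx; elim: n => //= n ->. Qed.

(** By Bezout, some multiple of [d] exceeds a multiple of [p] by one. *)
Lemma prime_torsion_free (T : Type) (g : T -> T) p d x : prime p ->
  iter p g x = x -> (0 < d < p)%N -> iter d g x = x -> g x = x.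
Proof.
move=> p_pr gp /andP[d0 dp] gd; have cop : coprime d p.
  by rewrite coprime_sym prime_coprime // gtnNdvd.
have [[u v] /= uv] := coprimeP p d0 cop.
have : iter (u * d) g x = x by rewrite iterM iter_fixed.
have -> : (u * d = (v * p).+1)%N by lia.
by rewrite iterS iterM iter_fixed.
Qed.

(** * Free torsion in terms of fixed points *)

Section FreeTorsionCriterion.
Variable R : address -> address -> Prop.
Hypotheses (tsR : type_system R) (scR : strongly_connected R).
Local Notation G := (stabilizerV R).

(** An algebraically disjoint [f] moving [x] would force a return of [x] under [g] in fewer than 5
    steps. With 5 at most the prime [p], this makes [x] a fixed point of [g]. *)
Lemma free_has_free_torsion g p : prime p -> (5 <= p)%N -> G g ->
  (forall x, iter p g x = x) -> (forall x, g x <> x) -> has_free_torsion G p.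
Proof.
move=> p_pr p5 Gg gp gfree; exists g; split=> //.
  by apply/funext => x; rewrite iter_comp.
move=> f Gf fid dj; apply: fid; apply/funext => x; apply: contrapT => fx.
apply: (algebraically_disjoint_short_orbit tsR scR Gf Gg dj fx) => d /andP[d0 d5] gd.
by apply: (gfree x); apply: (prime_torsion_free p_pr (gp x)) gd; lia.
Qed.

(** Each iteration lengthens the image of [a] by the length of [c], yet the [p]-th iterate returns
    to [a]. *)
Lemma torsion_act_extension g p a c : (0 < p)%N -> (forall x, iter p g x = x) ->
  address_act g a (a ++ c) -> c = [::].
Proof.
move=> p0 gp ac.
have [s sP ss] : exists2 s, address_act (iter p g) a (a ++ s) & size s = (p * size c)%N.
  elim: p {p0 gp} => [|p [s sP ss]]; first by exists [::] => //; rewrite cats0.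
  exists (c ++ s); last by rewrite size_cat ss mulSn.
  by move=> w; rewrite iterS sP catA; exact: address_act_cat.
have := address_act_uniq sP (_ : address_act (iter p g) a a).
move=> /(_ (fun w => gp _)) /(congr1 size); rewrite size_cat ss => E.
by apply: size0nil; move: p0 E; case: (size c) => // n; nia.
Qed.

Lemma torsion_act_comparable g p a b : (0 < p)%N -> (forall x, iter p g x = x) ->
  address_act g a b -> prefix a b || prefix b a -> a = b.
Proof.
move=> p0 gp ab /orP[/prefixP[c bE]|/prefixP[c aE]].
  by move: ab; rewrite bE => /(torsion_act_extension p0 gp) ->; rewrite cats0.
have gK : cancel g (iter p.-1 g) by move=> x; rewrite -iterSr prednK.
have := address_act_inv gK ab; rewrite aE => /(torsion_act_extension p0) -> //.
  by rewrite cats0.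
by move=> x; rewrite -iterM mulnC iterM iter_fixed.
Qed.

(** Around a fixed point [x], a long prefix [a] and its image are comparable, hence equal, so [g] is
    trivial on a whole cone. A transposition inside that cone is then algebraically disjoint from
    [g]. *)
Lemma has_free_torsion_free p : (0 < p)%N -> has_free_torsion G p ->
  exists g, [/\ G g, forall x, iter p g x = x & forall x, g x <> x].
Proof.
move=> p0 [g [Gg gp gfree]].
have gpx x : iter p g x = x by rewrite -iter_comp gp.
exists g; split=> // x gx; have /thompsonVP[gb [N gN]] := Gg.1.
pose a := xtake N x; have [|b ab] := gN a; first by rewrite size_xtake.
have ax : in_cone a x by exact: in_cone_xtake.
have bx : in_cone b x by rewrite -gx (in_cone_act _ (bij_inj gb) ab).
have aE := torsion_act_comparable p0 gpx ab (in_cone_comparable ax bx).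
have [c [d [e [[ac ad _] [cd _ _ Rcd _]]]]] := three_addresses tsR scR a.
have Gf : G (swap c d) by exact: swap_stabilizerV.
apply: (gfree _ Gf (swap_neq_id cd)).
apply: (supported_algebraically_disjoint tsR scR Gf Gg (swap_supported ac ad)).
by move=> y /in_coneP[w ->]; rewrite ab -aE.
Qed.

End FreeTorsionCriterion.

(** * Divisibility of the root *)

Section DivisibleCode.
Variable m : nat -> nat.
Hypothesis m_gt0 : forall k, (0 < m k)%N.
Local Notation st := (state_of m).
Local Notation unit_state k := (pos k (m k)).

(** [c] is a multiset of states, given by multiplicities, that occurs as the states of the members
    of a code. Below, [q == r] serves as the multiset with one copy of [q]. *)
Let realizable (c : state -> nat) : Prop :=
  exists L, is_code L /\ forall q, count (fun a => st a == q) L = c q.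

Let realizable_ext c d : (forall q, c q = d q) -> realizable c -> realizable d.
Proof. by move=> cd [L [cL Lc]]; exists L; split=> // q; rewrite Lc cd. Qed.

Let realizable_step q c : realizable (fun r => (q == r) + c r)%N ->
  realizable (fun r => (step m q false == r) + (step m q true == r) + c r)%N.
Proof.
move=> [L [cL Lc]].
have /hasP[a aL /eqP aq] : has (fun a => st a == q) L.
  by rewrite has_count Lc eqxx.
have pL := perm_to_rem aL; exists ((a ++ [:: false]) :: (a ++ [:: true]) :: rem a L).
split; first by apply: (code_split _ _).1; exact: is_code_perm pL cL.
move=> r; have := Lc r; rewrite (permP pL) /= aq => /addnI <-.
by rewrite !state_of_cat aq addnA.
Qed.

(** Each of [j] splittings along the left sheds one unit of the next level; [Zero] remains. *)
Let realizable_pos k j c : realizable (fun r => (pos k j == r) + c r)%N ->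
  realizable (fun r => (Zero == r) + (j * (unit_state k.+1 == r) + c r))%N.
Proof.
elim: j c => [|j IH] c; first by apply: realizable_ext => r.
move=> /realizable_step /= H.
apply: (@realizable_ext (fun r => (Zero == r) + (j * (unit_state k.+1 == r) +
  ((unit_state k.+1 == r) + c r)))%N); first by move=> r; lia.
by apply: IH; apply: realizable_ext H => r; lia.
Qed.

Let realizable_units k n c : realizable (fun r => n * (unit_state k == r) + c r)%N ->
  realizable (fun r => n * (Zero == r) + (n * m k * (unit_state k.+1 == r) + c r))%N.
Proof.
elim: n c => [|n IH] c; first by apply: realizable_ext => r.
move=> H; have /realizable_pos H1 : realizable
    (fun r => (unit_state k == r) + (n * (unit_state k == r) + c r))%N.
  by apply: realizable_ext H => r; lia.
have /IH : realizable (fun r => n * (unit_state k == r) +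
    ((Zero == r) + (m k * (unit_state k.+1 == r) + c r)))%N.
  by apply: realizable_ext H1 => r; lia.
by apply: realizable_ext => r; lia.
Qed.

Let realizable_level k : exists M N, (0 < N)%N /\
  realizable (fun r => M * (Zero == r) + N * (unit_state k == r))%N.
Proof.
elim: k => [|k [M [N [N0 H]]]].
  exists 0%N, 1%N; split=> //; exists [:: [::]]; split; first exact: is_code_nil.
  by move=> q /=; rewrite addn0 mul1n.
exists (M + N)%N, (N * m k)%N; split; first by rewrite muln_gt0 N0 m_gt0.
have /realizable_units : realizable (fun r => N * (unit_state k == r) + M * (Zero == r))%N.
  by apply: realizable_ext H => r; lia.
by apply: realizable_ext => r; lia.
Qed.

(** Splitting [Zero] and then the resulting [Neg] recovers [Zero] and adds one root and one
    [Neg]. *)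
Let realizable_Zero t c : realizable (fun r => (Zero == r) + c r)%N ->
  realizable (fun r => (Zero == r) + (t * (unit_state 0 == r) + t * (Neg == r) + c r))%N.
Proof.
elim: t c => [|t IH] c; first by apply: realizable_ext => r.
move=> /realizable_step /= H.
have /realizable_step /= H1 : realizable (fun r => (Neg == r) + ((unit_state 0 == r) + c r))%N.
  by apply: realizable_ext H => r; lia.
have /IH : realizable (fun r => (Zero == r) + ((Neg == r) + (unit_state 0 == r) + c r))%N.
  by apply: realizable_ext H1 => r; lia.
by apply: realizable_ext => r; lia.
Qed.

Let realizable_Neg t c : realizable (fun r => (Neg == r) + c r)%N ->
  realizable (fun r => (Neg == r) + (t * (Zero == r) + c r))%N.
Proof.
elim: t c => [|t IH] c; first by apply: realizable_ext => r.
move=> /realizable_step /= H.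
have /IH : realizable (fun r => (Neg == r) + ((Zero == r) + c r))%N.
  by apply: realizable_ext H => r; lia.
by apply: realizable_ext => r; lia.
Qed.

(* Expand the root into M copies of [Zero] and N of [unit_state k.+1], with m k dividing N;
   then p = m k expansions of a [Zero], and enough expansions of a [Neg] to bring the
   number of [Zero]s up to p M. *)
Lemma divisible_code k : exists L, is_code L /\
  forall q, (m k %| count (fun a => st a == q) L)%N.
Proof.
have [M [N [N0 H]]] := realizable_level k; set p := m k.
have p0 : (0 < p)%N by exact: m_gt0.
have /realizable_units H1 : realizable (fun r => N * (unit_state k == r) + M * (Zero == r))%N.
  by apply: realizable_ext H => r; lia.
pose M' := (M + N).-1.
have M'E : (M + N = M'.+1)%N by rewrite /M' prednK // addn_gt0 N0 orbT.
have /(realizable_Zero p) H2 : realizable (fun r => (Zero == r) +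
    (M' * (Zero == r) + N * p * (unit_state k.+1 == r)))%N.
  apply: realizable_ext H1 => r; rewrite -/p.
  by have := congr1 (muln^~ (Zero == r)) M'E; lia.
have /(realizable_Neg (p.-1 * M'.+1)) : realizable (fun r => (Neg == r) +
    (M'.+1 * (Zero == r) + N * p * (unit_state k.+1 == r) +
    p * (unit_state 0 == r) + p.-1 * (Neg == r)))%N.
  apply: realizable_ext H2 => r.
  by have := congr1 (muln^~ (Neg == r)) (prednK p0); lia.
move=> [L [cL Lc]]; exists L; split=> // q; rewrite Lc.
apply/dvdnP; exists (M'.+1 * (Zero == q) + N * (unit_state k.+1 == q) +
  (unit_state 0 == q) + (Neg == q))%N.
by have := congr1 (muln^~ (M'.+1 * (Zero == q))%N) (prednK p0);
  have := congr1 (muln^~ (Neg == q)) (prednK p0); lia.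
Qed.

End DivisibleCode.

Section Weight.
Import GRing.Theory.
Local Open Scope ring_scope.

(** Merging siblings leaves the sum unchanged and ends with the trivial code. *)
Lemma code_sum (V : zmodType) (F : address -> V) L :
  (forall a, F a = F (a ++ [:: false]) + F (a ++ [:: true])) -> is_code L ->
  \sum_(a <- L) F a = F [::].
Proof.
move=> Fadd; move: {2}(size L) (leqnn (size L)) => n.
elim: n L => [|n IH] L sL cL.
  by have [a] := code_cover (fun=> false) cL; case: L sL {cL}.
have [->|[u [M [pL cM]]]] := code_contract cL; first by rewrite big_seq1.
rewrite (perm_big _ pL) !big_cons /= addrA -Fadd -(IH _ _ cM) ?big_cons //.
by move: sL; rewrite (perm_size pL).
Qed.

Variables (m : nat -> nat) (p : nat).
Hypotheses (p_pr : prime p) (m_pr : forall k, prime (m k)) (mp : forall k, m k <> p).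
Local Notation st := (state_of m).

Definition prod_m k : 'F_p := \prod_(i < k) (m i)%:R.

Definition weight (q : state) : 'F_p :=
  match q with Zero => 0 | Neg => -1 | Pos k j => j.+1%:R / prod_m k.+1 end.

(** Primes other than [p] are invertible modulo [p], so the fractions defining the weight make sense
    there. *)
Let m_neq0 k : (m k)%:R != 0 :> 'F_p.
Proof.
rewrite -(dvdn_pcharf (pchar_Fp p_pr)) dvdn_prime2 //.
by apply/eqP => E; apply: (mp (k := k)).
Qed.

Let weight_pos k j : weight (pos k j) = j%:R / prod_m k.+1.
Proof. by case: j => //=; rewrite mul0r. Qed.

Let weight_unit k : weight (pos k (m k)) = (prod_m k)^-1.
Proof.
rewrite weight_pos /prod_m big_ord_recr /= invfM mulrCA divff ?mulr1 //.
Qed.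

Let weight_step q : weight q = weight (step m q false) + weight (step m q true).
Proof.
case: q => [||k j].
- by rewrite /step weight_unit /prod_m big_ord0 invr1 /= addrN.
- by rewrite /= addr0.
- by rewrite [weight (Pos k j)]/= /step weight_pos weight_unit -natr1 mulrDl mul1r.
Qed.

Lemma code_weight L : is_code L -> \sum_(a <- L) weight (st a) = 1.
Proof.
move=> cL; rewrite (code_sum (F := fun a => weight (st a))) //.
  by rewrite /state_of /= weight_unit /prod_m big_ord0 invr1.
by move=> a; rewrite weight_step !state_of_cat.
Qed.

End Weight.

(** * No free torsion at the other primes *)

Section Obstruction.
Import GRing.Theory.
Local Open Scope ring_scope.
Variables (m : nat -> nat) (p : nat) (g : cantor -> cantor).
Hypotheses (p_pr : prime p) (m_pr : forall k, prime (m k)) (mp : forall k, m k <> p).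
Hypothesis Gg : stabilizerV (same_state m) g.
Hypotheses (gp : forall x, iter p g x = x) (gfree : forall x, g x <> x).
Local Notation st := (state_of m).

(* The points whose length-N prefix is least among those of their orbit form a union of
   cones whose p translates by the powers of g partition the Cantor space.  The total
   weight 1 would thus be p times the weight of that union. *)
Lemma no_free_torsion : False.
Proof.
have p0 : (0 < p)%N := prime_gt0 p_pr.
have m_gt0 k : (0 < m k)%N := prime_gt0 (m_pr k).
have gG := stabilizerV_group (same_state m).
have [T TP] : {T : nat -> nat & forall d, acts_at (iter d g) (T d) /\
    forall a a', (T d <= size a)%N -> address_act (iter d g) a a' -> st a = st a'}.
  apply: (@choice _ _ (fun d N => acts_at (iter d g) N /\
    forall a a', (N <= size a)%N -> address_act (iter d g) a a' -> st a = st a')) => d.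
  have Gd := group_iter d gG Gg.
  have dE : iter d (comp g) id = iter d g by apply/funext => x; rewrite iter_comp.
  rewrite dE in Gd; have /thompsonVP[_ [N1 N1P]] := Gd.1.
  have [N2 N2P] := stabilizerV_preserves_state m_gt0 Gd.
  exists (N1 + N2)%N; split; first by apply: acts_at_le N1P; rewrite leq_addr.
  by move=> a a' sa; apply: N2P; apply: leq_trans sa; rewrite leq_addl.
(* From length [N] on, all powers of [g] up to the [p]-th act and preserve states. *)
pose N := \max_(d < p.+1) T d.
have TN d : (d <= p)%N -> (T d <= N)%N.
  by rewrite -ltnS => dp; exact: (leq_bigmax (Ordinal dp)).
have iter_bij d : bijective (iter d g).
  have Gd := group_iter d gG Gg; have := thompsonV_bij Gd.1.
  by rewrite (_ : iter d (comp g) id = iter d g) //; apply/funext => x; rewrite iter_comp.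
(* A repeated prefix would make an address comparable with its image, hence equal to it; then a
   power of [g], and so [g] itself, would fix [x]. *)
have disp x d : (0 < d < p)%N -> xtake N x <> xtake N (iter d g x).
  move=> dp E; have /andP[_ /ltnW dlp] := dp.
  have [|b ab] := (TP d).1 (xtake N x); first by rewrite size_xtake TN.
  have ax : in_cone (xtake N x) (iter d g x) by rewrite /in_cone size_xtake E.
  have bx : in_cone b (iter d g x).
    by rewrite (in_cone_act _ (bij_inj (iter_bij d)) ab) in_cone_xtake.
  have ip y : iter p (iter d g) y = y by rewrite -iterM mulnC iterM iter_fixed.
  have aE := torsion_act_comparable p0 ip ab (in_cone_comparable ax bx).
  apply: (@gfree x); apply: (prime_torsion_free p_pr (gp x) dp).
  by have := ab (xdrop N x); rewrite -aE prepend_xtake.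
(* As [pickle] is injective, this gives a strict order on distinct prefixes. *)
pose rk x : nat := pickle (xtake N x).
have rkP x d : (0 < d < p)%N -> rk x <> rk (iter d g x).
  by move=> /disp dx /(pcan_inj pickleK); exact: dx.
pose fund x := [forall d : 'I_p, (0 < d)%N ==> (rk x < rk (iter d g x))%N].
have iter_mod k x : iter k g x = iter (k %% p) g x.
  by rewrite [in LHS](divn_eq k p) addnC iterD iterM [in X in iter _ g X]iter_fixed.
have fund1 x : (\sum_(i < p) fund (iter i g x) = 1)%N.
  have [i0 _ i0min] := @arg_minnP _ (Ordinal p0) xpredT (fun i : 'I_p => rk (iter i g x)) isT.
  rewrite (bigD1 i0) //= big1 ?addn0 => [|i ii0].
    apply/eqP; rewrite eqb1; apply/forallP => d; apply/implyP => d0.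
    have dp : (0 < d < p)%N by rewrite d0 ltn_ord.
    have /eqP := rkP (iter i0 g x) d dp; rewrite ltn_neqAle => -> /=.
    rewrite -iterD (iter_mod (d + i0)%N).
    exact: (i0min (Ordinal (ltn_pmod (d + i0) p0)) isT).
  apply/eqP; rewrite eqb0; apply/negP => /forallP fi.
  have [d d0 dE] : exists2 d : 'I_p, (0 < d)%N & iter d g (iter i g x) = iter i0 g x.
    (* The difference of [i0] and [i] modulo [p]. *)
    exists (Ordinal (ltn_pmod (i0 + (p - i)) p0)) => /=.
      rewrite lt0n; apply: contra ii0 => di; apply/eqP/val_inj => /=.
      have := ltn_ord i; have := ltn_ord i0; move: di; rewrite -/(dvdn p _) => di i0p ip.
      have /dvdnP[[|[|c]] E] := di; lia.
    rewrite -[LHS]/(iter ((i0 + (p - i)) %% p) g (iter i g x)) -(iter_mod (i0 + (p - i))%N).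
    by rewrite -iterD -addnA (subnK (ltnW (ltn_ord i))) iterD gp.
  have := fi d; rewrite d0 /= dE ltnNge i0min //.
(* Since the [p]-th power is trivial, [iter (p - i) g] is the inverse of [iter i g]. *)
have [im imP] : {im : nat * address -> address & forall u, (u.1 <= p)%N ->
    size u.2 = (N + N)%N -> address_act (iter (p - u.1) g) u.2 (im u)}.
  apply: (@choice _ _ (fun u b => (u.1 <= p)%N -> size u.2 = (N + N)%N ->
    address_act (iter (p - u.1) g) u.2 b)) => -[i w] /=.
  case: (boolP ((i <= p) && (size w == N + N))%N) => [/andP[ip /eqP sw]|nip].
    have [|b bP] := (TP (p - i)%N).1 w; last by exists b.
    by rewrite sw (leq_trans (TN _ _)) ?leq_addr // leq_subr.
  by exists w => ip sw; move: nip; rewrite ip sw eqxx.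
(* The first [N] letters of the iterates decide [fund], and they depend only on the first [N + N]
   letters of the point. *)
pose W := [seq w <- words (N + N) | fund (prepend w (fun=> false))].
pose L := [seq im (i, w) | i <- iota 0 p, w <- W].
have fund_local x y : xtake (N + N) x = xtake (N + N) y -> fund x = fund y.
  move=> xy; have rkE d : (d <= p)%N -> rk (iter d g x) = rk (iter d g y).
    move=> dp; rewrite /rk; congr pickle.
    have [|b bP] := (TP d).1 (xtake (N + N) x).
      by rewrite size_xtake (leq_trans (TN _ dp)) ?leq_addr.
    have sb : (N <= size b)%N.
      by apply: (act_size_ge (TP d).1 _ bP); rewrite size_xtake leq_add2r TN.
    apply: xtake_le sb _; rewrite -{1}(prepend_xtake (N + N) x) bP xtake_prepend.
    by rewrite -(prepend_xtake (N + N) y) -xy bP xtake_prepend.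
  by apply: eq_forallb => d; rewrite (rkE 0%N) // rkE // ltnW.
have WP w : w \in W -> size w = (N + N)%N.
  by rewrite mem_filter mem_words => /andP[_ /eqP].
(* A point lies in the [i]-th translate exactly when its image under [iter i g] satisfies [fund],
   and by [fund1] this holds for exactly one [i]. *)
have cL : is_code L.
  move=> x; rewrite -(fund1 x) -sum1_count big_mkcond big_allpairs_dep /=.
  rewrite -[X in iota 0 X]subn0 -/(index_iota 0 p) big_mkord; apply: eq_bigr => i _.
  rewrite -big_mkcond sum1_count; set y := iter i g x.
  have -> : count (fun w => in_cone (im (val i, w)) x) W = count (in_cone^~ y) W.
    apply: eq_in_count => w /WP sw.
    have ax := imP (val i, w) (ltnW (ltn_ord i)) sw.
    have yx : iter (p - i) g y = x by rewrite /y -iterD (subnK (ltnW (ltn_ord i))) gp.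
    by rewrite -{1}yx; exact: in_cone_act (bij_inj (iter_bij _)) ax.
  rewrite count_filter (@eq_in_count _ _ (fun w => (w == xtake (N + N) y) && fund y)).
    case: (fund y); last by rewrite (eq_count (a2 := pred0)) ?count_pred0 // => w; rewrite andbF.
    rewrite (eq_count (a2 := pred1 (xtake (N + N) y))); last by move=> w; rewrite /= andbT.
    by rewrite count_uniq_mem ?words_uniq // mem_words size_xtake eqxx.
  move=> w; rewrite mem_words => /eqP sw /=; rewrite /in_cone sw eq_sym.
  case: eqP => //= wE; apply: fund_local.
  by rewrite -{1}sw xtake_prepend.
have := code_weight p_pr m_pr mp cL; rewrite big_allpairs_dep /=.
(* States are preserved, so all [p] translates have the same weight and the total vanishes modulo
   [p]. *)
rewrite (eq_big_seq (fun=> \sum_(w <- W) weight m p (st w))) => [|i]; last first.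
  rewrite mem_iota add0n => /andP[_ ip]; apply: eq_big_seq => w /WP sw; congr weight.
  apply/esym/((TP (p - i)%N).2 w (im (i, w))); last exact: (imP (i, w) (ltnW ip)).
  by rewrite sw (leq_trans (TN _ _)) ?leq_addr // leq_subr.
rewrite big_const_seq count_predT size_iota iter_addr addr0 -mulr_natr.
have := dvdn_pcharf (pchar_Fp p_pr) p; rewrite dvdnn => /esym/eqP ->.
by rewrite mulr0 => /eqP; rewrite eq_sym oner_eq0.
Qed.

End Obstruction.

(** * The family of subgroups *)

Lemma free_torsion_primes m p : injective m -> (forall k, prime (m k)) -> prime p ->
  (5 <= p)%N -> has_free_torsion (stabilizerV (same_state m)) p <-> exists k, m k = p.
Proof.
move=> m_inj m_pr p_pr p5; have m_gt0 k : (0 < m k)%N := prime_gt0 (m_pr k).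
have tsR := same_state_type_system m_gt0; have scR := @same_state_strongly_connected m.
split=> [tor|[k mk]].
  have [g [Gg gp gfree]] := has_free_torsion_free tsR scR (prime_gt0 p_pr) tor.
  apply: contrapT => /forallNP nmp.
  exact: (no_free_torsion p_pr m_pr nmp Gg gp gfree).
have [L [cL pL]] := divisible_code m_gt0 k; rewrite mk in pL.
have [//|g [Gg gp gfree]] := code_free_torsion tsR (st := state_of m) _ cL (prime_gt1 p_pr) pL.
exact: (free_has_free_torsion tsR scR p_pr p5 Gg gp gfree).
Qed.

(** The sequence starts at 5, the bound required by the torsion criterion. *)
Fixpoint big_prime (n : nat) : nat :=
  if n is k.+1 then s2val (prime_above (big_prime k)) else 5.

Lemma big_prime_prime n : prime (big_prime n).
Proof. by case: n => //= n; case: (prime_above _). Qed.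

Lemma big_prime_mono : {homo big_prime : i j / (i < j)%N}.
Proof.
apply: (@homo_ltn _ _ (fun i j => i < j)%N) => [j i k|i]; first exact: ltn_trans.
by rewrite /=; case: (prime_above _).
Qed.

Lemma big_prime_inj : injective big_prime.
Proof.
move=> i j E; case: (ltngtP i j) => // /big_prime_mono; by rewrite E ltnn.
Qed.

Lemma big_prime_ge5 n : (5 <= big_prime n)%N.
Proof. by case: n => // n; apply/ltnW/(big_prime_mono (ltn0Sn n)). Qed.

(** The bit [b k] chooses one of two primes reserved for [k], so the set of values determines
    [b]. *)
Definition coded_prime (b : nat -> bool) (k : nat) : nat := big_prime (k.*2 + b k).

Lemma coded_prime_eq b b' k l : coded_prime b k = coded_prime b' l -> k = l /\ b k = b' l.
Proof.
move=> /big_prime_inj E; have kl : k = l by case: (b k) (b' l) E => -[] /=; lia.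
by split=> //; move: E; rewrite kl => /addnI; case: (b l) (b' l) => -[].
Qed.

Lemma coded_prime_inj b : injective (coded_prime b).
Proof. by move=> k l /coded_prime_eq[]. Qed.

Definition coded_group (b : nat -> bool) : set (cantor -> cantor) :=
  stabilizerV (same_state (coded_prime b)).

(** One inclusion is enough, because exactly one prime of each reserved pair occurs for [b']. *)
Lemma coded_group_eq b b' :
  (forall p, has_free_torsion (coded_group b) p -> has_free_torsion (coded_group b') p) ->
  b = b'.
Proof.
move=> H; have pr c k : prime (coded_prime c k) := big_prime_prime _.
apply/funext => k; have p5 : (5 <= coded_prime b k)%N := big_prime_ge5 _.
have /H : has_free_torsion (coded_group b) (coded_prime b k).
  by apply/free_torsion_primes; [exact: coded_prime_inj | exact: pr | exact: pr | | exists k].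
move=> /free_torsion_primes[||//||l /coded_prime_eq[<- ->]] //.
exact: coded_prime_inj.
Qed.

Lemma coded_groups_uncountable : ~ countable (range coded_group).
Proof.
move=> /countable_injP[f finj].
have inj b b' : f (coded_group b) = f (coded_group b') -> b = b'.
  move=> E; apply: coded_group_eq; suff -> : coded_group b = coded_group b' by [].
  by apply: finj => //; apply/mem_set; [exists b | exists b'].
(* Cantor's diagonal sequence: its bit at [n] negates that of the sequence whose group has number
   [n], if there is one. *)
pose d n := ~~ `[< exists2 b, f (coded_group b) = n & b n >].
set n := f (coded_group d); have dn : d n = ~~ d n; last by case: (d n) dn.
rewrite {1}/d; congr (~~ _); apply/asboolP/idP => [[b /inj ->] //|dn].
by exists d.
Qed.

Theorem theorem7p5 :
  exists M : set (set (cantor_space -> cantor_space)),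
    [/\ ~ countable M,
        forall G, M G -> maximal_subgroup thompsonV G,
        forall G H, M G -> M H -> G <> H -> ~ isomorphic G H &
        forall G, M G ->
          [/\ exists R : address -> address -> Prop,
                [/\ simple_type_system R, nuclear_type_system R &
                    G = stabilizerV R],
              ~ preserves_circular_order_on_dense_set G &
              forall F : set cantor_space, finite_set F -> F !=set0 ->
                ~ stabilizes_setwise G F]].
Proof.
have m_gt0 b k : (0 < coded_prime b k)%N := prime_gt0 (big_prime_prime _).
have ts b := same_state_type_system (m_gt0 b).
have sc b := @same_state_strongly_connected (coded_prime b).
have simple b := same_state_simple (m_gt0 b) (@coded_prime_inj b).
exists (range coded_group); split; first exact: coded_groups_uncountable.
- by move=> _ [b _ <-]; exact: simple_maximal (simple b) (sc b).
- move=> _ _ [b _ <-] [b' _ <-] ne iso; apply: ne; congr coded_group.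
  apply: coded_group_eq => p.
  by apply: has_free_torsion_isomorphic iso; exact: stabilizerV_group.
- move=> _ [b _ <-]; split.
  + exists (same_state (coded_prime b)); split=> //.
    exact: strongly_connected_nuclear (ts b) (sc b).
  + exact: stabilizerV_no_circular_order (ts b) (sc b).
  + by move=> F; exact: stabilizerV_no_finite_orbit (ts b) (sc b) F.
Qed.
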